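(* Let $\mathcal{L}$ be a finite relational language, $T$ a complete $\mathcal L$-theory with monster model $\mathcal U$ and small $M\prec\mathcal U$. Suppose $\mu\in\mathfrak{M}_x^{\mathrm{inv}}(\mathcal{U},M)$ does not concentrate on points and satisfies the excellent measure extension axiom, and let $N$ be the unique countable $\mathcal L$-structure with $\mathbb{P}_\mu(B_N)=1$. Let $G:S^+_{\mathbf x}(\mathcal U)\to X_{\mathcal L}$ be the map $p\mapsto (f^R_p)_{R\in\mathcal L}$. Then the push-forward measure $G_*(\mathbb P_\mu)$ on $X_{\mathcal L}$ satisfies: (1) $G_*(\mathbb P_\mu)$ is invariant under the action of $\mathrm{Sym}(\mathbb N)$ on $X_{\mathcal L}$; (2) $G_*(\mathbb P_\mu)(\{g\in X_{\mathcal L}: A_g\cong N\})=1$. Consequently, $N$ has trivial group-theoretic definable closure.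
   Context: Keisler measures: for a (possibly infinite) tuple of variables $x$ and $A\subseteq\mathcal U$, $S_x(A)$ is the Stone space of complete types over $A$; a Keisler measure is a finitely additive probability measure on $\mathcal L(A)$-formulas in $x$, identified with its regular Borel extension to $S_x(A)$; $[\varphi]$ is the clopen set of types containing $\varphi$. $\mu\in\mathfrak M_x(\mathcal U)$ is $M$-invariant if $\mu(\varphi(x,a))=\mu(\varphi(x,b))$ for all $\mathcal L$-formulas $\varphi(x,y)$ and $a\equiv_M b$; these form $\mathfrak M^{\mathrm{inv}}_x(\mathcal U,M)$. For small $N'\supseteq M$ and an $\mathcal L(N')$-formula $\varphi(x,y)$, $F^\varphi_{\mu,N'}:S_y(N')\to[0,1]$, $q\mapsto\mu(\varphi(x,b))$, $b\models q$. Borel-definable over $M$: all $F^\varphi_{\mu,M}$ Borel. Morley product (for $\mu$ Borel-definable): $(\mu\otimes\nu)(\varphi(x,y))=\int_{S_y(N')}F^\varphi_{\mu,N'}\,d(\nu|_{N'})$, $N'\supseteq M$ small containing the parameters. $\mu^{(1)}=\mu(x_1)$, $\mu^{(n+1)}=\mu(x_{n+1})\otimes\mu^{(n)}(x_1,\dots,x_n)$. $M$-adequate: $\mu$ and all $\mu^{(n)}$ Borel-definable over $M$ and iterated Morley products of $\mu$ independent of parenthesization; $M$-excellent: additionally $\mu_x\otimes\mu_y=\mu_y\otimes\mu_x$. $\mathbb P_\mu$ is the regular Borel probability measure on $S_{\mathbf x}(\mathcal U)$, $\mathbf x=(x_i)_{i\ge1}$, with $\mathbb P_\mu([\varphi(x_1,\dots,x_n)])=\mu^{(n)}(\varphi(x_1,\dots,x_n))$.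 $\mu$ does not concentrate on points if $\mu(x=a)=0$ for all $a\in\mathcal U$. For $p\in S_{\mathbf x}(\mathcal U)$, $p_{\mathcal L}$ is the isomorphism type of the substructure induced on $\{a_i:i\ge1\}$ for any realization $(a_i)$ of $p$ in an elementary extension of $\mathcal U$; $B_N=\{p:p_{\mathcal L}\cong N\}$. $\mathrm{diag}_{\bar a}(x_1,\dots,x_n)$ is the conjunction of atomic and negated atomic $\mathcal L$-formulas true of $\bar a$. Excellent measure extension axiom: $\mu$ is $M$-excellent and for all $a_1,\dots,a_{n+1}\in\mathcal U$, $\bar a=(a_1,\dots,a_n)$, if $(\mu_{x_{n+1}}\otimes\mu^{(n)})(\mathrm{diag}_{\bar a,a_{n+1}}(x_1,\dots,x_{n+1}))>0$ then $\mu^{(n)}|_M\big([\mathrm{diag}_{\bar a}(x_1,\dots,x_n)]\cap\{q\in S_{x_1..x_n}(M): \mu(\neg\mathrm{diag}_{\bar a,a_{n+1}}(\bar c,x_{n+1}))=1\text{ for }\bar c\models q\}\big)=0$. $S^+_{\mathbf x}(\mathcal U)=\{p\in S_{\mathbf x}(\mathcal U): (x_m\neq x_n)\in p \text{ for all distinct } m,n\ge1\}$. With $\mathbb N=\{1,2,\dots\}$, $X_{\mathcal L}=\prod_{R\in\mathcal L}2^{\mathbb N^{r_R}}$ ($r_R$ the arity of $R$) is the space of labeled $\mathcal L$-structures on $\mathbb N$; $g\in X_{\mathcal L}$ determines the structure $A_g$ on $\mathbb N$. $f^R_p(i_1,\dots,i_{r_R})=1$ iff $R(x_{i_1},\dots,x_{i_{r_R}})\in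 p$. $\mathrm{Sym}(\mathbb N)$ acts on $X_{\mathcal L}$ by relabeling. A structure $N$ has trivial group-theoretic definable closure if for every finite $A\subseteq N$, the set of elements of $N$ fixed by every automorphism of $N$ fixing $A$ pointwise is exactly $A$. *)

(* Defs.v *)
From HB Require Import structures.
From mathcomp Require Import all_boot all_order all_algebra.
From mathcomp Require Import all_classical all_reals all_analysis.

Set Implicit Arguments.
Unset Strict Implicit.
Unset Printing Implicit Defensive.

Import numFieldNormedType.Exports.
Local Open Scope classical_set_scope.
Local Open Scope card_scope.
Local Open Scope ring_scope.

Record language := Language { sym :> finType ; arity : sym -> nat }.

Record structure (L : language) := Structure {
  carrier :> Type ;
  interp : forall r : L, ('I_(arity r) -> carrier) -> Prop ;
  inhab : inhabited carrier }.
Arguments interp {L} s r _.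

(* [fml L V] is the type of L-formulas with free variables named in V; under a
   quantifier the new variable is [None] and the old ones are [Some v]. *)
Inductive fml (L : language) (V : Type) : Type :=
| FTop
| FEq of V & V
| FRel (r : L) of 'I_(arity r) -> V
| FNeg of fml L V
| FAnd of fml L V & fml L V
| FEx of fml L (option V).
Arguments FTop {L V}.
Arguments FEq {L V} _ _.
Arguments FRel {L V} r _.
Arguments FNeg {L V} _.
Arguments FAnd {L V} _ _.
Arguments FEx {L V} _.

Definition FOr (L : language) (V : Type) (f g : fml L V) : fml L V :=
  FNeg (FAnd (FNeg f) (FNeg g)).

Definition FAnds (L : language) (V : Type) (s : seq (fml L V)) : fml L V :=
  foldr FAnd FTop s.

Fixpoint fml_map (L : language) (V W : Type) (s : V -> W) (f : fml L V) : fml L W :=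
  match f with
  | FTop => FTop
  | FEq v w => FEq (s v) (s w)
  | FRel r i => FRel r (s \o i)
  | FNeg g => FNeg (fml_map s g)
  | FAnd g h => FAnd (fml_map s g) (fml_map s h)
  | FEx g => FEx (fml_map (omap s) g)
  end.

Fixpoint fml_vars (L : language) (V : Type) (f : fml L V) : set V :=
  match f with
  | FTop => set0
  | FEq v w => [set v; w]
  | FRel r i => range i
  | FNeg g => fml_vars g
  | FAnd g h => fml_vars g `|` fml_vars h
  | FEx g => Some @^-1` fml_vars g
  end.

Fixpoint sat (L : language) (A : structure L) (V : Type) (f : fml L V) :
    (V -> A) -> Prop :=
  match f with
  | FTop => fun=> True
  | FEq v w => fun e => e v = e w
  | FRel r i => fun e => interp A r (e \o i)
  | FNeg g => fun e => ~ sat g e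
  | FAnd g h => fun e => sat g e /\ sat h e
  | FEx g => fun e => exists a : A, sat g (oapp e a)
  end.

Definition sentence (L : language) := fml L void.

Definition holds (L : language) (A : structure L) (s : sentence L) : Prop :=
  sat s (of_void A).

Definition model (L : language) (A : structure L) (T : set (sentence L)) : Prop :=
  forall s, T s -> holds A s.

Definition entails (L : language) (T : set (sentence L)) (s : sentence L) : Prop :=
  forall A : structure L, model A T -> holds A s.

Definition complete_theory (L : language) (T : set (sentence L)) : Prop :=
  (exists A : structure L, model A T) /\
  forall s, entails T s \/ entails T (FNeg s).

Definition is_isomorphism (L : language) (A B : structure L) (h : A -> B) : Prop :=
  bijective h /\ forall r i, interp A r i <-> interp B r (h \o i).

Definition isomorphic (L : language) (A B : structure L) : Prop :=
  exists h : A -> B, is_isomorphism h.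

Definition is_automorphism (L : language) (A : structure L) (h : A -> A) : Prop :=
  is_isomorphism h.

Definition elementary_map (L : language) (A B : structure L) (j : A -> B) : Prop :=
  forall (V : Type) (f : fml L V) (e : V -> A), sat f e <-> sat f (j \o e).

Lemma inhab_set (A : Type) (D : set A) : D !=set0 -> inhabited D.
Proof. by case=> x Dx; exists; exists x; rewrite inE. Qed.

Definition induced_structure (L : language) (A : structure L) (D : set A)
    (D0 : D !=set0) : structure L :=
  @Structure L D (fun r i => interp A r (set_val \o i)) (inhab_set D0).

Definition elementary_substructure (L : language) (U : structure L)
    (M : set U) : Prop :=
  exists M0 : M !=set0, elementary_map (set_val : induced_structure M0 -> U).

(* A formula in the tuple of variables X with parameters in U is an L-formula
   whose free variables are named in X + U. *)
Definition pfml (L : language) (U : structure L) (X : Type) : Type :=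
  fml L (X + U).

Section Types.
Variables (L : language) (U : structure L).

Definition params_in (X : Type) (A : set U) : set (pfml U X) :=
  [set f | forall u : U, fml_vars f (inr u) -> A u].

Definition no_param (X : Type) (f : fml L X) : pfml U X := fml_map inl f.

Definition vmap (X Y : Type) (s : X -> Y) (f : pfml U X) : pfml U Y :=
  fml_map (fun v => match v with inl x => inl (s x) | inr u => inr u end) f.

(* [phi(x, y)] becomes [phi(x, b)] *)
Definition plug (X Y : Type) (f : pfml U (X + Y)) (b : Y -> U) : pfml U X :=
  fml_map (fun v => match v with
    | inl (inl x) => inl x | inl (inr y) => inr (b y) | inr u => inr u end) f.

Definition params (X : Type) (f : pfml U X) : set U := [set u | fml_vars f (inr u)].

Definition assign (X : Type) (V : Type) (e : X -> V) (j : U -> V) (v : X + U) : V :=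
  match v with inl x => e x | inr u => j u end.

Definition psat (X : Type) (f : pfml U X) (e : X -> U) : Prop :=
  sat f (assign e id).

(* Complete types over A in the variables X, i.e. the points of S_X(A);
   consistency with the elementary diagram of U is finite satisfiability in U. *)
Record stype (X : Type) (A : set U) := SType {
  formulas :> pfml U X -> Prop ;
  formulas_over : formulas `<=` params_in A ;
  formulas_sat : forall F : set (pfml U X), finite_set F -> F `<=` formulas ->
    exists e : X -> U, forall f, F f -> psat f e ;
  formulas_complete : forall f, params_in A f -> formulas f \/ formulas (FNeg f) }.

Section Point.
Variables (X : Type) (A : set U) (e : X -> U).

Let tp : set (pfml U X) := [set f | params_in A f /\ psat f e].

Let tp_over : tp `<=` params_in A. Proof. by move=> f []. Qed.

Let tp_sat (F : set (pfml U X)) : finite_set F -> F `<=` tp ->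
  exists e : X -> U, forall f, F f -> psat f e.
Proof. by move=> _ FT; exists e => f /FT[]. Qed.

Let tp_complete f : params_in A f -> tp f \/ tp (FNeg f).
Proof. by move=> Af; have [fe|fe] := pselect (psat f e); [left|right]. Qed.

Definition type_of_tuple : stype X A := SType tp_over tp_sat tp_complete.
End Point.

Definition clopen_of (X : Type) (A : set U) (f : pfml U X) : set (stype X A) :=
  [set p : stype X A | p f].
Arguments clopen_of {X} A f _.

Section Topology.
Variables (X : Type) (A : set U).

HB.instance Definition _ := gen_eqMixin (stype X A).
HB.instance Definition _ := gen_choiceMixin (stype X A).
HB.instance Definition _ := isPointed.Build (stype X A)
  (type_of_tuple A (fun=> match cid (let: inhabits u := inhab U in
     ex_intro (fun=> True) u I) with exist u _ => u end)).

Definition stone_open : set (set (stype X A)) :=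
  [set O : set (stype X A) | forall p, O p ->
    exists f, [/\ params_in A f, clopen_of A f p & clopen_of A f `<=` O]].

Lemma stypeT (p : stype X A) : p FTop.
Proof.
have [//|nT] := @formulas_complete _ _ p FTop (fun u => False_ind _).
have [|_ ->|e /(_ _ erefl)] := @formulas_sat _ _ p [set FNeg FTop] => //.
by case.
Qed.

Lemma stype_and (p : stype X A) f g : p (FAnd f g) <-> p f /\ p g.
Proof.
have no (F : set (pfml U X)) : finite_set F ->
    F `<=` p -> (forall e, (forall h, F h -> psat h e) -> False) -> False.
  by move=> Ff Fp Fe; have [e /Fe] := formulas_sat Ff Fp.
have fin3 (a b c : pfml U X) : finite_set [set a; b; c].
  by rewrite !finite_setU; split; [split|]; exact: finite_set1.
have sub3 (a b c : pfml U X) : p a -> p b -> p c -> [set a; b; c] `<=` p.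
  by move=> pa pb pc h [[->|->]|->].
split=> [pfg|[pf pg]].
  have ofg := formulas_over pfg.
  have of' : params_in A f by move=> u fu; apply: ofg; left.
  have og' : params_in A g by move=> u gu; apply: ofg; right.
  split.
    have [//|pn] := formulas_complete p of'.
    exfalso; apply: (no [set FAnd f g; FNeg f; FNeg f]) => //; first exact: sub3.
    move=> e h; have [] : psat (FAnd f g) e by apply: h; do 2 left.
    by have : psat (FNeg f) e by apply: h; right.
  have [//|pn] := formulas_complete p og'.
  exfalso; apply: (no [set FAnd f g; FNeg g; FNeg g]) => //; first exact: sub3.
  move=> e h; have [] : psat (FAnd f g) e by apply: h; do 2 left.
  by have : psat (FNeg g) e by apply: h; right.
have ofg : params_in A (FAnd f g).
  by move=> u [/(formulas_over pf)|/(formulas_over pg)].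
have [//|pn] := formulas_complete p ofg.
exfalso; apply: (no [set f; g; FNeg (FAnd f g)]) => //; first exact: sub3.
move=> e h; have : psat (FNeg (FAnd f g)) e by apply: h; right.
by apply; split; apply: h; left; [left|right].
Qed.

Let stone_openT : stone_open setT.
Proof. by move=> p _; exists FTop; split => //; exact: stypeT. Qed.

Let stone_openI : setI_closed stone_open.
Proof.
move=> O1 O2 h1 h2 p [/h1[f [of' pf fO]] /h2[g [og pg gO]]].
exists (FAnd f g); split; first by move=> u [/of'|/og].
- exact/stype_and.
- by move=> q /stype_and[qf qg]; split; [exact: fO|exact: gO].
Qed.

Let stone_open_bigcup (I : Type) (O : I -> set (stype X A)) :
  (forall i, stone_open (O i)) -> stone_open (\bigcup_i O i).
Proof.
move=> h p [i _ Op]; have [f [of' pf fO]] := h i p Op.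
by exists f; split=> // q /fO Oq; exists i.
Qed.

HB.instance Definition _ := isOpenTopological.Build (stype X A)
  stone_openT stone_openI stone_open_bigcup.

End Topology.

Definition realizes (X : Type) (A : set U) (p : stype X A)
    (V : structure L) (j : U -> V) (a : X -> V) : Prop :=
  forall f, p f -> sat f (assign a j).

(* The cardinal kappa of the monster model is given as that of a type K, and
   "small" means of cardinality less than kappa. *)
Definition small (K : Type) (A : set U) : Prop := ~ ([set: K] #<= A).

Definition saturated (K : Type) : Prop :=
  forall A : set U, small K A ->
  forall p : stype 'I_1 A, exists b : 'I_1 -> U, realizes p id b.

Definition strongly_homogeneous (K : Type) : Prop :=
  forall (A : set U) (s : U -> U), small K A ->
  (forall f : fml L U, fml_vars f `<=` A -> (sat f id <-> sat f s)) ->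
  exists2 h : U -> U, is_automorphism h & {in A, h =1 s}.

Definition monster (K : Type) : Prop :=
  [/\ ~ countable [set: K], saturated K & strongly_homogeneous K].

End Types.
Arguments clopen_of {L U X} A f _.

Notation borel T := (g_sigma_algebraType (@open T)).

Definition regular_measure (R : realType) (T : ptopologicalType)
    (m : probability (borel T) R) : Prop :=
  forall B : set (borel T), measurable B ->
    m B = ereal_inf [set m O | O in [set O : set T | open O /\ B `<=` O]] /\
    m B = ereal_sup [set m C | C in [set C : set T |
                               [/\ compact C, closed C & C `<=` B]]].

Section Keisler.
Variables (R : realType) (L : language) (U : structure L).

Definition keisler_measure (X : Type) (mu : pfml U X -> R) : Prop :=
  [/\ forall f g, (forall e, psat f e <-> psat g e) -> mu f = mu g,
      forall f, 0 <= mu f,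
      mu FTop = 1 &
      forall f g, (forall e, ~ (psat f e /\ psat g e)) ->
        mu (FOr f g) = mu f + mu g].

Definition same_type (n : nat) (M : set U) (a b : 'I_n -> U) : Prop :=
  forall f : pfml U 'I_n, params_in M f -> (psat f a <-> psat f b).

Definition invariant_over (X : Type) (M : set U) (mu : pfml U X -> R) : Prop :=
  keisler_measure mu /\
  forall (n : nat) (f : fml L (X + 'I_n)) (a b : 'I_n -> U),
    same_type M a b -> mu (plug (no_param U f) a) = mu (plug (no_param U f) b).

(* The map F^phi_{mu,A} : S_Y(A) -> [0,1], q |-> mu(phi(x,b)) for b |= q; the
   value does not depend on b when A contains a model over which mu is
   invariant, and a realization b in U exists when A is small. *)
Definition fiber (X Y : Type) (mu : pfml U X -> R) (A : set U)
    (f : pfml U (X + Y)) (q : stype Y A) : R :=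
  get [set r | exists2 b : Y -> U, realizes q id b & r = mu (plug f b)].

Definition borel_definable (X : Type) (M : set U) (mu : pfml U X -> R) : Prop :=
  forall (n : nat) (f : pfml U (X + 'I_n)), params_in M f ->
    measurable_fun [set: borel (stype 'I_n M)] (fiber mu f).

Definition extends_to (X : Type) (nu : pfml U X -> R) (A : set U)
    (m : probability (borel (stype X A)) R) : Prop :=
  regular_measure m /\ forall f, params_in A f -> m (clopen_of A f) = (nu f)%:E.

(* nu|_A as a regular Borel probability measure on S_X(A); the Dirac measure is
   a junk value for functions nu that are not Keisler measures. *)
Definition restriction (X : Type) (nu : pfml U X -> R) (A : set U) :
    probability (borel (stype X A)) R :=
  match pselect (exists m, extends_to nu (A := A) m) with
  | left h => projT1 (cid h)
  | right _ => dirac (point : borel (stype X A))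
  end.

(* mu_x (x) nu_y for mu Borel-definable over M, computed on phi(x,y) over the
   least admissible set of parameters containing M. *)
Definition morley (X Y : Type) (M : set U) (mu : pfml U X -> R)
    (nu : pfml U Y -> R) (f : pfml U (X + Y)) : R :=
  let A := M `|` params f in
  Rintegral (restriction nu A) setT (fiber mu f : borel (stype Y A) -> R).

(* (x_1, ..., x_{n+2}) as the pair of x_{n+2} and (x_1, ..., x_{n+1}) *)
Definition split_last (n : nat) (i : 'I_n.+2) : 'I_1 + 'I_n.+1 :=
  match unlift ord_max i with Some j => inr j | None => inl ord0 end.

(* [morley_power M mu n] is mu^(n+1), in the variables x_1, ..., x_{n+1}, where
   x_{i+1} is named by the element i of 'I_n.+1. *)
Fixpoint morley_power (M : set U) (mu : pfml U 'I_1 -> R) (n : nat) :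
    pfml U 'I_n.+1 -> R :=
  match n with
  | 0 => mu
  | m.+1 => fun f => morley M mu (@morley_power M mu m) (vmap (@split_last m) f)
  end.
Arguments morley_power M mu n f : clear implicits.

(* Parenthesized products of copies of mu. *)
Inductive ptree := PLeaf | PNode of ptree & ptree.

Fixpoint pvar (t : ptree) : Type :=
  match t with PLeaf => 'I_1 | PNode l r => (pvar l + pvar r)%type end.

(* number of leaves, minus one *)
Fixpoint psize (t : ptree) : nat :=
  match t with PLeaf => 0 | PNode l r => (psize l + psize r).+1 end.

(* The variables are numbered from right to left, as in the definition
   mu^(n+1) = mu(x_{n+1}) (x) mu^(n)(x_1, ..., x_n). *)
Fixpoint pindex (t : ptree) : pvar t -> nat :=
  match t with
  | PLeaf => fun=> 0
  | PNode l r => fun v => match v with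
      | inl v => (pindex v + (psize r).+1)%N | inr v => pindex v end
  end.

Fixpoint pproduct (M : set U) (mu : pfml U 'I_1 -> R) (t : ptree) :
    pfml U (pvar t) -> R :=
  match t with
  | PLeaf => mu
  | PNode l r => morley M (@pproduct M mu l) (@pproduct M mu r)
  end.
Arguments pproduct M mu t f : clear implicits.

Definition adequate (M : set U) (mu : pfml U 'I_1 -> R) : Prop :=
  (forall n, borel_definable M (morley_power M mu n)) /\
  forall (t : ptree) (f : pfml U (pvar t)),
    pproduct M mu t f =
    morley_power M mu (psize t) (vmap (fun v => inord (pindex v) : 'I_(psize t).+1) f).

Definition sum_swap (X Y : Type) (v : X + Y) : Y + X :=
  match v with inl x => inr x | inr y => inl y end.

Definition excellent (M : set U) (mu : pfml U 'I_1 -> R) : Prop :=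
  adequate M mu /\
  forall f : pfml U ('I_1 + 'I_1),
    morley M mu mu f = morley M mu mu (vmap (@sum_swap _ _) f).

Definition not_on_points (mu : pfml U 'I_1 -> R) : Prop :=
  forall a : U, mu (FEq (inl ord0) (inr a)) = 0.

Definition atoms (n : nat) : seq (fml L 'I_n) :=
  [seq FEq i j | i <- enum 'I_n, j <- enum 'I_n] ++
  flatten [seq [seq FRel r i | i : {ffun 'I_(arity r) -> 'I_n}] | r : L].

Definition diag (n : nat) (a : 'I_n -> U) : fml L 'I_n :=
  FAnds [seq (if `[< sat f a >] then f else FNeg f) | f <- atoms n].

(* The tuple a below is (a_1, ..., a_{n+2}), so that its restriction along
   [lift ord_max] is (a_1, ..., a_{n+1}). *)
Definition extension_axiom (M : set U) (mu : pfml U 'I_1 -> R) : Prop :=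
  excellent M mu /\
  forall (n : nat) (a : 'I_n.+2 -> U),
    let da := no_param U (diag (a \o lift ord_max)) in
    let daa := vmap (@split_last n) (no_param U (diag a)) in
    0 < morley M mu (morley_power M mu n) daa ->
    restriction (morley_power M mu n) M
      (clopen_of M da `&` [set q | fiber mu (FNeg daa) q = 1]) = 0%E.

Definition is_Pmu (M : set U) (mu : pfml U 'I_1 -> R)
    (P : probability (borel (stype nat [set: U])) R) : Prop :=
  regular_measure P /\
  forall (n : nat) (f : pfml U 'I_n.+1),
    P (clopen_of setT (vmap (@nat_of_ord n.+1) f)) = (morley_power M mu n f)%:E.

End Keisler.
Arguments morley_power {R L U} M mu n f.
Arguments pproduct {R L U} M mu t f.

Section Labeled.
Variable L : language.

(* B_N: the substructure on the range of a realization of p, in an elementary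
   extension V of U, is isomorphic to N. *)
Definition BN (U N : structure L) : set (stype nat [set: U]) :=
  [set p : stype nat [set: U] | exists (V : structure L) (j : U -> V) (a : nat -> V)
             (a0 : range a !=set0),
     [/\ elementary_map j, realizes p j a & isomorphic (induced_structure a0) N]].

Definition Splus (U : structure L) : set (stype nat [set: U]) :=
  [set p : stype nat [set: U] | forall m n : nat, m <> n -> p (FNeg (FEq (inl m) (inl n)))].

Definition XL : Type :=
  prod_topology (fun r : L => {ptws ('I_(arity r) -> nat) -> bool}).

Definition labeled (g : XL) : structure L :=
  @Structure L nat (fun r i => g r i : Prop) (inhabits 0%N).

Definition Gmap (U : structure L) (p : stype nat [set: U]) : XL :=
  fun r i => `[< p (FRel r (fun k => inl (i k))) >].

(* G is only considered on S^+, hence the intersection. *)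
Definition Gpush (R : realType) (U : structure L)
    (P : probability (borel (stype nat [set: U])) R) (B : set (borel XL)) : \bar R :=
  P (@Splus U `&` @Gmap U @^-1` B).

Record SymN := {
  sperm :> nat -> nat ;
  sinv : nat -> nat ;
  spermK : cancel sperm sinv ;
  sinvK : cancel sinv sperm }.

Definition relabel (s : SymN) (g : XL) : XL := fun r i => g r (sinv s \o i).

Definition gdcl (N : structure L) (A : set N) : set N :=
  [set c | forall h : N -> N, is_automorphism h -> (forall a, A a -> h a = a) ->
             h c = c].

Definition trivial_gdcl (N : structure L) : Prop :=
  forall A : set N, finite_set A -> gdcl A = A.

End Labeled.
Arguments BN {L} U N _.
Arguments Splus {L} U _.

(* Main.v *)
Require Import Defs.
From mathcomp Require Import all_boot all_order all_algebra finmap zify.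
From mathcomp Require Import all_classical all_reals all_analysis.

(* By the change-of-variables formula in the fibres, commutation of mu with
   itself and associativity make every mu^(n) symmetric: transposing the two
   outermost variables is a symmetry of the fibres of (mu (x) mu) (x) mu^(n),
   and other adjacent transpositions act on the measure against which one
   integrates. Hence P_mu is invariant under permutations of the variables, and
   so is its image on X_L, as the two measures agree on the pi-system of
   cylinders.

   The isomorphism class of N is Borel by Scott's theorem, applied both to X_L
   and to the space of types; in the latter case the structures come from
   realizations of the types in ultrapowers of U. As mu does not charge points,
   S^+ has full measure, and there B_N is the preimage of the isomorphism class.

   If c outside A were fixed by all automorphisms fixing the finite set A
   pointwise, then for a fixed labelling of A the events "c has label z", for z
   ranging over the unused labels, would be disjoint and have equal probability,
   hence be null; but one of countably many such events occurs almost surely. *)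

Set Implicit Arguments.
Unset Strict Implicit.
Unset Printing Implicit Defensive.

Import Order.TTheory GRing.Theory Num.Theory.

Local Open Scope classical_set_scope.
Local Open Scope card_scope.
Local Open Scope ring_scope.

(** * Formulas and substitution *)

Section Substitution.
Variable L : language.

Lemma fml_map_comp (V W Z : Type) (s : V -> W) (t : W -> Z) (f : fml L V) :
  fml_map t (fml_map s f) = fml_map (t \o s) f.
Proof.
elim: f W Z s t => {V}[V|V v w|V r i|V g IH|V g IHg h IHh|V g IH] W Z s t //=.
- by rewrite IH.
- by rewrite IHg IHh.
- by rewrite IH; congr (FEx (fml_map _ _)); apply/funext => -[].
Qed.

Lemma eq_fml_map (V W : Type) (s t : V -> W) (f : fml L V) :
  (forall v, fml_vars f v -> s v = t v) -> fml_map s f = fml_map t f.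
Proof.
elim: f W s t => {V}[V|V v w|V r i|V g IH|V g IHg h IHh|V g IH] W s t //= st.
- by rewrite !st//=; [right|left].
- by congr FRel; apply/funext => k /=; apply: st; exists k.
- by rewrite (IH _ _ t).
- by rewrite (IHg _ _ t) ?(IHh _ _ t)// => v ?; apply: st; [right|left].
- rewrite (IH _ _ (omap t))// => -[v|]//= /st ->//.
Qed.

Lemma fml_map_id (V : Type) (f : fml L V) : fml_map id f = f.
Proof.
elim: f => {V}[V|V v w|V r i|V g IH|V g IHg h IHh|V g IH] //=.
- by rewrite IH.
- by rewrite IHg IHh.
- by rewrite -[in RHS]IH; congr (FEx (fml_map _ _)); apply/funext => -[].
Qed.

Lemma sat_fml_map (A : structure L) (V W : Type) (s : V -> W) (f : fml L V) (e : W -> A) :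
  sat (fml_map s f) e <-> sat f (e \o s).
Proof.
elim: f W s e => {V}[V|V v w|V r i|V g IH|V g IHg h IHh|V g IH] W s e //=.
- by rewrite IH.
- by rewrite IHg IHh.
- split=> -[a ga]; exists a; move: ga; rewrite IH => ga; congr (sat g _): ga;
    by apply/funext => -[].
Qed.

Lemma fml_vars_map (V W : Type) (s : V -> W) (f : fml L V) :
  fml_vars (fml_map s f) = s @` fml_vars f.
Proof.
elim: f W s => {V}[V|V v w|V r i|V g IH|V g IHg h IHh|V g IH] W s /=.
- by rewrite image_set0.
- by rewrite image_setU !image_set1.
- by rewrite image_comp.
- exact: IH.
- by rewrite image_setU IHg IHh.
- rewrite IH; apply/seteqP; split=> w /=.
    by move=> [[v|]//= gv [<-]]; exists v.
  by move=> [v gv <-]; exists (Some v).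
Qed.

Lemma finite_fml_vars (V : Type) (f : fml L V) : finite_set (fml_vars f).
Proof.
elim: f => {V}[V|V v w|V r i|V g IH|V g IHg h IHh|V g IH] //=.
- by apply: finite_image; exact: finite_finset.
- by rewrite finite_setU.
- by apply: finite_preimage => // x y _ _ [].
Qed.

End Substitution.

Section Variables.
Variables (L : language) (U : structure L).

Lemma vmap_comp (X Y Z : Type) (s : X -> Y) (t : Y -> Z) (f : pfml U X) :
  vmap t (vmap s f) = vmap (t \o s) f.
Proof. by rewrite /vmap fml_map_comp; apply: eq_fml_map => -[]. Qed.

Lemma eq_vmap (X Y : Type) (s t : X -> Y) (f : pfml U X) :
  (forall x, fml_vars f (inl x) -> s x = t x) -> vmap s f = vmap t f.
Proof. by move=> st; apply: eq_fml_map => -[x /st ->|]. Qed.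

Lemma vmap_id (X : Type) (f : pfml U X) : vmap id f = f.
Proof. by rewrite -[RHS]fml_map_id; apply: eq_fml_map => -[]. Qed.

Lemma params_vmap (X Y : Type) (s : X -> Y) (f : pfml U X) :
  params (vmap s f) = params f.
Proof.
rewrite /params /vmap fml_vars_map; apply/seteqP; split=> u /=.
  by move=> [[x|v]//= fv [<-]].
by move=> fu; exists (inr u).
Qed.

Lemma params_in_vmap (A : set U) (X Y : Type) (s : X -> Y) (f : pfml U X) :
  params_in A (vmap s f) <-> params_in A f.
Proof.
have e Z (g : pfml U Z) : params_in A g <-> params g `<=` A by [].
by rewrite !e params_vmap.
Qed.

Lemma psat_vmap (X Y : Type) (s : X -> Y) (f : pfml U X) (e : Y -> U) :
  psat (vmap s f) e <-> psat f (e \o s).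
Proof.
rewrite /psat /vmap sat_fml_map.
by split=> h; congr (sat f _): h; apply/funext => -[].
Qed.

Lemma plug_vmapl (X X' Y : Type) (s : X -> X') (f : pfml U (X + Y)) (b : Y -> U) :
  plug (vmap (fun v => match v with inl x => inl (s x) | inr y => inr y end) f) b =
  vmap s (plug f b).
Proof. by rewrite /plug /vmap !fml_map_comp; apply: eq_fml_map => -[[]|]. Qed.

Lemma plug_vmapr (X Y Y' : Type) (s : Y -> Y') (f : pfml U (X + Y)) (b : Y' -> U) :
  plug (vmap (fun v => match v with inl x => inl x | inr y => inr (s y) end) f) b =
  plug f (b \o s).
Proof. by rewrite /plug /vmap !fml_map_comp; apply: eq_fml_map => -[[]|]. Qed.

(** A formula in infinitely many variables mentions finitely many of them, so it is already measured
    by some finite Morley power. *)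
Lemma vars_bounded (f : pfml U nat) :
  exists n, forall i, fml_vars f (inl i) -> (i <= n)%N.
Proof.
have fin : finite_set (inl @^-1` fml_vars f : set nat).
  by apply: finite_preimage; [move=> x y _ _ []|exact: finite_fml_vars].
have /finite_seqP[s fs] := fin; exists (\max_(i <- s) i) => i fi.
have : (inl @^-1` fml_vars f) i by [].
by rewrite fs => /= si; exact: (@leq_bigmax_seq _ s xpredT id i si isT).
Qed.

End Variables.

(** * Realizing types in ultrapowers *)

Section Ultrapower.
Context (I : Type) (F : set_system I) {FU : UltraFilter F}.
Variables (L : language) (U : structure L).

Let cls (f : I -> U) : set (I -> U) := [set g | \forall i \near F, f i = g i].

(** The quotient is the type of equivalence classes taken as sets, so that equality modulo the
    ultrafilter becomes plain equality. *)
Definition ultrapower_carrier : Type :=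
  {c : set (I -> U) | exists f, c = cls f}.

Definition ultrapower_class (f : I -> U) : ultrapower_carrier :=
  exist _ (cls f) (ex_intro _ f erefl).

Definition ultrapower_repr (c : ultrapower_carrier) : I -> U := projT1 (cid (projT2 c)).

Lemma ultrapower_reprK c : ultrapower_class (ultrapower_repr c) = c.
Proof. by rewrite /ultrapower_repr; case: cid => f; case: c => c h /= e; exact: eq_exist. Qed.

Lemma eq_ultrapower_class f g :
  ultrapower_class f = ultrapower_class g <-> \forall i \near F, f i = g i.
Proof.
split=> [[fg]|fg].
  suff : cls f g by [].
  by rewrite fg; exact: nearW.
apply: eq_exist; apply/seteqP; split=> h /= fh; near=> i.
  by transitivity (f i); [symmetry; near: i|near: i].
by transitivity (g i); near: i.
Unshelve. all: by end_near. Qed.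

Lemma ultrapower_inhab : inhabited ultrapower_carrier.
Proof. by case: (inhab U) => u; exists; exact: (ultrapower_class (fun=> u)). Qed.

Definition ultrapower : structure L :=
  @Structure L ultrapower_carrier
    (fun r c => \forall i \near F, interp U r (fun k => ultrapower_repr (c k) i))
    ultrapower_inhab.

Lemma Los V (f : fml L V) (e : V -> I -> U) :
  @sat L ultrapower V f (fun v => ultrapower_class (e v)) <->
  \forall i \near F, sat f (fun v => e v i).
Proof.
elim: f e => {V}[V|V v w|V r x|V g IH|V g IHg h IHh|V g IH] e /=.
- by split=> // _; exact: nearW.
- exact: eq_ultrapower_class.
(* Chosen representatives agree with [e] only almost everywhere; finiteness of the arity gives one
   large set of indices for all arguments. *)
- have ex : \forall i \near F, forall k,
      ultrapower_repr (ultrapower_class (e (x k))) i = e (x k) i.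
    apply: filter_forall => k; apply/eq_ultrapower_class.
    exact: ultrapower_reprK.
  split; apply: filterS2 ex => i /funext exi.
    by rewrite [X in interp U r X]exi.
  by move=> h; rewrite [X in interp U r X]exi.
- rewrite IH; split=> [nF|Fn Fg].
    by have [//|] := in_ultra_setVsetC [set i | sat g (e^~ i)] FU.
  have /filter_ex[i []] : \forall i \near F, sat g (e^~ i) /\ ~ sat g (e^~ i).
    exact: filterI.
  by [].
- rewrite IHg IHh; split=> [[]|gh]; first exact: filterI.
  by split; apply: filterS gh => i [].
- split=> [[a ga]|].
    have /IH : @sat L ultrapower _ g
        (fun v => ultrapower_class (oapp e (ultrapower_repr a) v)).
      congr (sat g _): ga; apply/funext => -[v|] //=.
      by rewrite ultrapower_reprK.
    apply: filterS => i gi; exists (ultrapower_repr a i).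
    by congr (sat g _): gi; apply/funext => -[v|].
  (* [u0] fills in at the indices without a witness, which form a set outside the ultrafilter. *)
  have [u0] := inhab U => gF.
  have /choice[u uP] : forall i, exists u, (exists a, sat g (oapp (e^~ i) a)) ->
      sat g (oapp (e^~ i) u).
    move=> i; have [[a ga]|] := pselect (exists a, sat g (oapp (e^~ i) a)).
      by exists a.
    by exists u0.
  exists (ultrapower_class u).
  have /IH : \forall i \near F, sat g (fun v => oapp e u v i).
    apply: filterS gF => i /uP gi.
    by congr (sat g _): gi; apply/funext => -[v|].
  by move=> gi; congr (sat g _): gi; apply/funext => -[v|].
Qed.

Lemma ultrapower_elementary :
  elementary_map (fun u : U => ultrapower_class (fun=> u) : ultrapower).
Proof.
move=> V f e; rewrite (@Los _ f (fun v _ => e v)); split=> [fe|].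
  exact: nearW.
by move=> /filter_ex[].
Qed.

End Ultrapower.

Section Realization.
Variables (L : language) (U : structure L) (X : Type) (A : set U).

(** The ultrapower is indexed by the formulas themselves: at index [g] in p one takes a tuple
    satisfying [g], and the ultrafilter contains, for each [f] in p, the set of members of p
    implying [f]. *)
Lemma stype_realized (p : stype X A) : exists (V : structure L) (j : U -> V) (a : X -> V),
  elementary_map j /\ realizes p j a.
Proof.
pose B (f : pfml U X) := [set g : pfml U X | p g /\ forall e, psat g e -> psat f e].
have FB : ProperFilter (filter_from p B).
  apply: filter_from_proper; last by move=> f pf; exists f; split.
  apply: filter_from_filter; first by exists FTop; exact: stypeT.
  move=> f g pf pg; exists (FAnd f g); first exact/stype_and.
  by move=> h [ph hfg]; split; split=> // e /hfg[].
have [F [FU BF]] := ultraFilterLemma FB.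
have /choice[e eP] : forall g : pfml U X, exists e : X -> U, p g -> psat g e.
  move=> g; have [pg|npg] := pselect (p g).
    have [|e ge] := @formulas_sat _ _ _ _ p [set g] (finite_set1 g).
      by move=> _ ->.
    by exists e => _; exact: (ge g).
  by have [u] := inhab U; exists (fun=> u).
exists (ultrapower F U), (fun u => ultrapower_class F (fun=> u)),
       (fun x => ultrapower_class F (fun g => e g x)).
split; first exact: ultrapower_elementary.
move=> f pf.
have /Los : \forall g \near F,
    sat f (fun v => (assign (fun x g => e g x) (fun u _ => u) v : pfml U X -> U) g).
  apply: BF; exists f => // g [pg gf]; have /gf := eP _ pg.
  by congr (sat f _); apply/funext => -[].
by congr (sat f _); apply/funext => -[].
Qed.

End Realization.

(** * Scott's isomorphism theorem *)

Section CountableLogic.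
Context d (T : measurableType d).
Implicit Types P Q : set T.

Lemma measurable_all (I : countType) (P : I -> set T) :
  (forall i, measurable (P i)) -> measurable [set w | forall i, P i w].
Proof.
move=> mP; have -> : [set w | forall i, P i w] = ~` \bigcup_i ~` P i.
  rewrite setC_bigcup; apply/seteqP; split=> w /= h i; first by move=> _; rewrite setCK; exact: h.
  by have := h i Logic.I; rewrite setCK.
apply: measurableC; apply: countable_bigcupT_measurable => // i.
exact: measurableC.
Qed.

Lemma measurable_ex (I : countType) (P : I -> set T) :
  (forall i, measurable (P i)) -> measurable [set w | exists i, P i w].
Proof.
move=> mP; have -> : [set w | exists i, P i w] = \bigcup_i P i.
  by apply/seteqP; split=> w /= [i]; exists i.
exact: countable_bigcupT_measurable.
Qed.

Lemma measurable_prop (p : Prop) : measurable [set _ : T | p].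
Proof.
have [h|h] := pselect p.
  have -> : [set _ : T | p] = setT by apply/seteqP; split.
  exact: measurableT.
have -> : [set _ : T | p] = set0 by apply/seteqP; split.
exact: measurable0.
Qed.

Lemma measurable_imp P Q : measurable P -> measurable Q ->
  measurable [set w | P w -> Q w].
Proof.
move=> mP mQ; have -> : [set w | P w -> Q w] = ~` P `|` Q.
  apply/seteqP; split=> w /= => [h|[//|//]].
  by have [/h|] := pselect (P w); [right|left].
by apply: measurableU => //; exact: measurableC.
Qed.

Lemma measurable_iff P Q : measurable P -> measurable Q ->
  measurable [set w | P w <-> Q w].
Proof. by move=> mP mQ; apply: measurableI; exact: measurable_imp. Qed.

End CountableLogic.

(** Serves both for the limit of a back-and-forth construction and, with [rho] equality, for two
    enumerations having the same atomic diagram. Enumerations may repeat elements, whence the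
    condition on equalities. *)
Lemma isomorphism_of_correspondence (L : language) (A B : structure L)
    (e : nat -> A) (nu : nat -> B) (rho : nat -> nat -> Prop) :
  (forall y, exists n, e n = y) -> (forall y, exists n, nu n = y) ->
  (forall x, exists c, rho x c) -> (forall c, exists x, rho x c) ->
  (forall x c x' c', rho x c -> rho x' c' -> (e x = e x' <-> nu c = nu c')) ->
  (forall (r : L) (x c : 'I_(arity r) -> nat), (forall k, rho (x k) (c k)) ->
     (interp A r (e \o x) <-> interp B r (nu \o c))) ->
  exists h : A -> B, is_isomorphism h /\ forall x c, rho x c -> h (e x) = nu c.
Proof.
move=> eS nuS tot1 tot2 req rrel.
have [xi xiP] := choice eS; have [eta etaP] := choice nuS.
have [f fP] := choice tot1; have [g gP] := choice tot2.
exists (fun y => nu (f (xi y))); split; last first.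
  move=> x c xc; apply/(req _ _ _ _ (fP _) xc).
  by rewrite xiP.
split.
  exists (fun y => e (g (eta y))) => y.
    rewrite -[RHS]xiP; apply/(req _ _ _ _ (gP _) (fP _)).
    by rewrite etaP.
  rewrite -[RHS]etaP; apply/(req _ _ _ _ (fP _) (gP _)).
  by rewrite xiP.
move=> r i.
have -> : i = e \o (xi \o i) by apply/funext => k /=; rewrite xiP.
rewrite (rrel _ _ (f \o (xi \o i))); last by move=> k; exact: fP.
suff -> : (fun y : A => nu (f (xi y))) \o (e \o (xi \o i)) =
          nu \o (f \o (xi \o i)) by [].
by apply/funext => k /=; rewrite xiP.
Qed.

Section Scott.
Context d (Om : measurableType d) (L : language).
Variables (A : Om -> structure L) (e : forall w, nat -> A w).
Hypothesis e_surj : forall w y, exists n, e w n = y.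
Hypothesis measurable_eq : forall i j, measurable [set w | e w i = e w j].
Hypothesis measurable_rel : forall (r : L) (i : 'I_(arity r) -> nat),
  measurable [set w | interp (A w) r (e w \o i)].
Variables (N : structure L) (nu : nat -> N).
Hypothesis nu_surj : forall y, exists n, nu n = y.

(** The constants z are carried along because the argument on definable closure prescribes the
    labels of finitely many elements. *)
Definition extends_to_iso (z : seq (nat * nat)) : set Om :=
  [set w | exists h : A w -> N, is_isomorphism h /\
     forall p, p \in z -> h (e w p.1) = nu p.2].

(* Semantic counterpart of the L_{omega_1,omega}-formulas: [Q s] is the event
   that the tuple s of (A w) satisfies the formula, and [q t] says that the
   tuple t of N satisfies it. *)
Definition definable (Q : seq nat -> set Om) (q : set (seq nat)) : Prop :=
  (forall s, measurable (Q s)) /\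
  forall w z, extends_to_iso z w -> (Q (unzip1 z) w <-> q (unzip2 z)).

Lemma definable_neg Q q : definable Q q ->
  definable (fun s => ~` Q s) [set t | ~ q t].
Proof.
move=> [mQ Qq]; split=> [s|w z wz /=]; first exact: measurableC.
by rewrite /setC /= (Qq _ _ wz).
Qed.

Lemma definable_all (I : countType) Q q : (forall i : I, definable (Q i) (q i)) ->
  definable (fun s => [set w | forall i, Q i s w]) [set t | forall i, q i t].
Proof.
move=> Qq; split=> [s|w z wz /=].
  by apply: measurable_all => i; have [] := Qq i.
by split=> h i; have [_ Qqi] := Qq i; apply/(Qqi _ _ wz).
Qed.

(** The isomorphism carries a witness across, and surjectivity of the enumerations gives it an
    index; the index joins z, so that the hypothesis on [Q] applies to the longer tuple. *)
Lemma definable_ex Q q : definable Q q ->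
  definable (fun s => [set w | exists x : nat, Q (x :: s) w])
            [set t | exists c : nat, q (c :: t)].
Proof.
move=> [mQ Qq]; split=> [s|w z [h [hi hz]] /=]; first exact: measurable_ex.
split=> [[x Qx]|[c qc]].
  have [c cx] := nu_surj (h (e w x)); exists c.
  apply/(Qq w ((x, c) :: z)) => //; exists h; split=> // p.
  by rewrite inE => /predU1P[->//|/hz].
have [[g gK hK] _] := hi; have [x xc] := e_surj (g (nu c)); exists x.
apply/(Qq w ((x, c) :: z)) => //; exists h; split=> // p.
by rewrite inE => /predU1P[->/=|/hz//]; rewrite xc.
Qed.

(** Equality of infinitary types of tuples of N, with [definable] in the role of the formulas. *)
Definition equiv (t t' : seq nat) : Prop :=
  forall Q q, definable Q q -> (q t <-> q t').

Lemma equiv_sym t t' : equiv t t' -> equiv t' t.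
Proof. by move=> tt' Q q dQ; split=> h; apply/(tt' _ _ dQ). Qed.

Lemma not_equiv t t' : ~ equiv t t' ->
  exists Qq, [/\ definable Qq.1 Qq.2, Qq.2 t & ~ Qq.2 t'].
Proof.
move=> /existsNP[Q /existsNP[q /not_implyP[dQ nq]]].
have [qt|qt] := pselect (q t).
  by exists (Q, q); split=> // qt'; apply: nq.
exists (fun s => ~` Q s, [set t | ~ q t]); split=> //=.
  exact: definable_neg.
by move=> qt'; apply: nq; tauto.
Qed.

(** If every c' failed, the countable conjunction of formulas separating c :: t from each c' :: t',
    put under an existential quantifier, would separate t from t'. *)
Lemma equiv_step t t' : equiv t t' ->
  forall c, exists c', equiv (c :: t) (c' :: t').
Proof.
move=> tt' c; apply: contrapT => /forallNP nc.
have {nc} /choice[F FP] : forall c', exists Qq,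
    [/\ definable Qq.1 Qq.2, Qq.2 (c :: t) & ~ Qq.2 (c' :: t')].
  by move=> c'; exact: not_equiv.
have /definable_ex dF : definable (fun s => [set w | forall c', (F c').1 s w])
    [set t | forall c', (F c').2 t].
  by apply: definable_all => c'; have [] := FP c'.
have [/= []] := tt' _ _ dF; first by exists c => c'; have [] := FP c'.
by move=> c' /(_ c'); have [] := FP c'.
Qed.

(** There are countably many tuples t', so the formulas separating t from the inequivalent ones have
    a conjunction within the logic. *)
Lemma isolating t : exists Qq,
  [/\ definable Qq.1 Qq.2, Qq.2 t & forall t', Qq.2 t' -> equiv t t'].
Proof.
have /choice[F FP] : forall t', exists Qq,
    [/\ definable Qq.1 Qq.2, Qq.2 t & Qq.2 t' -> equiv t t'].
  move=> t'; have [tt'|/not_equiv[Qq [? ? ?]]] := pselect (equiv t t').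
    exists (fun=> setT, setT); split=> //=; split=> //.
  by exists Qq; split.
exists (fun s => [set w | forall t', (F t').1 s w],
        [set t | forall t', (F t').2 t]); split.
- by apply: definable_all => t'; have [] := FP t'.
  by move=> t' /=; have [] := FP t'.
by move=> t' /= /(_ t'); have [] := FP t'.
Qed.

(** Arguments of relations are positions in z stored as finite functions, so that the quantifier
    ranges over a countable type. *)
Definition same_atoms (w : Om) (z : seq (nat * nat)) : Prop :=
  (forall i j : nat, (i < size z)%N -> (j < size z)%N ->
    (e w (nth 0 (unzip1 z) i)%N = e w (nth 0 (unzip1 z) j)%N <->
     nu (nth 0 (unzip2 z) i)%N = nu (nth 0 (unzip2 z) j)%N)) /\
  (forall (ri : {r : L & {ffun 'I_(arity r) -> nat}}),
     (forall k, (tagged ri k < size z)%N) ->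
    (interp (A w) (tag ri) (fun k => e w (nth 0 (unzip1 z) (tagged ri k))%N) <->
     interp N (tag ri) (fun k => nu (nth 0 (unzip2 z) (tagged ri k))%N))).

Lemma measurable_same_atoms z : measurable [set w | same_atoms w z].
Proof.
apply: measurableI.
  apply: measurable_all => i; apply: measurable_all => j.
  do 2 (apply: measurable_imp; first exact: measurable_prop).
  by apply: measurable_iff; [exact: measurable_eq|exact: measurable_prop].
apply: measurable_all => ri; apply: measurable_imp; first exact: measurable_prop.
apply: measurable_iff; [exact: measurable_rel|exact: measurable_prop].
Qed.

Lemma nth_unzip (z : seq (nat * nat)) i : (i < size z)%N ->
  nth (0, 0)%N z i = (nth 0 (unzip1 z) i, nth 0 (unzip2 z) i)%N.
Proof.
by move=> iz; rewrite (nth_map (0, 0)%N)// (nth_map (0, 0)%N)//; case: nth.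
Qed.

(** Outside the tuple [nth] returns the default index 0, whose elements on the two sides are
    unrelated; the condition on sizes rules this out. *)
Lemma definable_eq i j : definable
  (fun s => [set w | e w (nth 0 s i)%N = e w (nth 0 s j)%N /\
                     (i < size s)%N && (j < size s)%N])
  [set t | nu (nth 0 t i)%N = nu (nth 0 t j)%N /\
           (i < size t)%N && (j < size t)%N].
Proof.
split=> [s|w z [h [[[g hK gK] _] hz]] /=].
  by apply: measurableI; [exact: measurable_eq|exact: measurable_prop].
rewrite !size_map; split=> -[+ /andP[iz jz]]; rewrite iz jz.
  have := hz _ (mem_nth (0, 0)%N iz); have := hz _ (mem_nth (0, 0)%N jz).
  by rewrite !nth_unzip//= => <- <- ->.
have := hz _ (mem_nth (0, 0)%N iz); have := hz _ (mem_nth (0, 0)%N jz).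
by rewrite !nth_unzip//= => <- <- /(can_inj hK).
Qed.

Lemma definable_rel (r : L) (i : 'I_(arity r) -> nat) : definable
  (fun s => [set w | interp (A w) r (fun k => e w (nth 0 s (i k))%N) /\
                     forall k, (i k < size s)%N])
  [set t | interp N r (fun k => nu (nth 0 t (i k))%N) /\
           forall k, (i k < size t)%N].
Proof.
split=> [s|w z [h [[_ hr] hz]] /=].
  by apply: measurableI; [exact: measurable_rel|exact: measurable_prop].
rewrite !size_map hr.
have [iz|iz] := pselect (forall k, (i k < size z)%N); last by tauto.
suff -> : h \o (fun k => e w (nth 0 (unzip1 z) (i k))%N) =
  (fun k => nu (nth 0 (unzip2 z) (i k))%N) by [].
apply/funext => k /=; have := hz _ (mem_nth (0, 0)%N (iz k)).
by rewrite !nth_unzip.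
Qed.

Lemma same_atoms_nth w z : same_atoms w z -> forall p p', p \in z -> p' \in z ->
  (e w p.1 = e w p'.1 <-> nu p.2 = nu p'.2).
Proof.
move=> [h _] _ _ /(nthP (0, 0)%N)[i iz <-] /(nthP (0, 0)%N)[j jz <-].
by rewrite !nth_unzip//=; exact: h.
Qed.

Lemma same_atoms_rel w z : same_atoms w z ->
  forall (r : L) (x c : 'I_(arity r) -> nat), (forall k, (x k, c k) \in z) ->
  (interp (A w) r (e w \o x) <-> interp N r (nu \o c)).
Proof.
move=> [_ h] r x c xcz.
pose i := [ffun k => index (x k, c k) z].
have iz k : (i k < size z)%N by rewrite ffunE index_mem.
have := h (Tagged (fun r : L => {ffun 'I_(arity r) -> nat}) i) iz => /=.
have xc k : nth (0, 0)%N z (i k) = (x k, c k) by rewrite ffunE nth_index.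
have -> : (fun k => e w (nth 0 (unzip1 z) (i k))%N) = e w \o x.
  by apply/funext => k; have := xc k; rewrite nth_unzip// => -[->].
have -> // : (fun k => nu (nth 0 (unzip2 z) (i k))%N) = nu \o c.
by apply/funext => k; have := xc k; rewrite nth_unzip// => -[_ ->].
Qed.

(* Scott's isomorphism theorem, with constants: the set is defined by the
   conjunction of the Scott sentence of N and the formula isolating the type of
   the second components of z. *)
Lemma measurable_extends_to_iso z0 : measurable (extends_to_iso z0).
Proof.
have [F FP] := choice isolating.
(* The finite partial maps of the back-and-forth system: the first components satisfy in [A w] the
   formula isolating the type of the second ones. *)
pose W (z : seq (nat * nat)) : set Om := (F (unzip2 z)).1 (unzip1 z).
have mW z : measurable (W z) by have [[mF _] _ _] := FP (unzip2 z); exact: mF.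
pose good z : set Om := [set w |
  [/\ forall x : nat, exists c : nat, W ((x, c) :: z) w,
      forall c : nat, exists x : nat, W ((x, c) :: z) w & same_atoms w z]].
have mgood z : measurable (good z).
  rewrite (_ : good z = [set w | forall x : nat, exists c : nat, W ((x, c) :: z) w]
    `&` [set w | forall c : nat, exists x : nat, W ((x, c) :: z) w]
    `&` [set w | same_atoms w z]); last first.
    by apply/seteqP; split=> w [] => [|[]].
  apply: measurableI; last exact: measurable_same_atoms.
  by apply: measurableI; apply: measurable_all => x; apply: measurable_ex => c.
suff -> : extends_to_iso z0 = [set w | forall z, W z w -> good z w] `&` W z0.
  apply: measurableI => //.
  by apply: measurable_all => z; exact: measurable_imp.
apply/seteqP; split=> w.
  move=> wz0; have [h [hi hz0]] := wz0; split; last first.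
    have [[_ Fd] Ft _] := FP (unzip2 z0); exact/(Fd _ _ wz0).
  move=> z /= wz.
  have /choice[f fP] : forall x, exists c, nu c = h (e w x) by move=> x; exact: nu_surj.
  (* The isomorphism [h] need not respect z. In z' the second components are replaced by indices of
     the images under [h]; the isolating formula then makes the two second tuples equivalent. *)
  pose z' := [seq (p.1, f p.1) | p <- z].
  have z'1 : unzip1 z' = unzip1 z by rewrite /unzip1 -map_comp.
  have sz' : size z' = size z by rewrite size_map.
  have ez' : extends_to_iso z' w.
    by exists h; split=> // _ /mapP[p _ ->] /=; rewrite fP.
  have [[_ Fd] Ft Fe] := FP (unzip2 z).
  have eqv : equiv (unzip2 z) (unzip2 z').
    apply: Fe; apply/(Fd _ _ ez'); rewrite z'1; exact: wz.
  have Wext x c c' : extends_to_iso ((x, c') :: z') w ->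
      equiv (c :: unzip2 z) (c' :: unzip2 z') -> W ((x, c) :: z) w.
    move=> ez'' eqv'; rewrite /W /= -z'1.
    have [Gd Gt _] := FP (c :: unzip2 z).
    by apply/(Gd.2 _ _ ez'')/(eqv' _ _ Gd).
  split.
  (* Extend z' along [h], then copy the new element over to z by the back-and-forth property of
     [equiv]. *)
  - move=> x; have [c cP] := equiv_step (equiv_sym eqv) (f x).
    exists c; apply: (Wext _ _ _ _ (equiv_sym cP)); exists h; split=> // p.
    by rewrite inE => /predU1P[->//|/mapP[q _ ->]]; rewrite -fP.
  - move=> c; have [c' c'P] := equiv_step eqv c.
    have [[g hK gK] _] := hi; have [x xc'] := e_surj (g (nu c')).
    exists x; apply: (Wext _ _ _ _ c'P); exists h; split=> // p.
    rewrite inE => /predU1P[->/=|/mapP[q _ ->]]; last by rewrite -fP.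
    by rewrite xc'.
  split.
    (* Atomic formulas are definable, so they pass from z to z' by equivalence and from z' to [A w]
       by [h]. *)
    move=> i j iz jz; have dE := definable_eq i j.
    have := dE.2 _ _ ez'; have := eqv _ _ dE; rewrite /= z'1 !size_map iz jz /=.
    have isT := erefl true; rewrite -[true = true]/(is_true true) in isT; tauto.
  move=> ri iz; have dR := @definable_rel (tag ri) (tagged ri).
  have := dR.2 _ _ ez'; have := eqv _ _ dR; rewrite /= z'1 !size_map; tauto.
move=> [/= S Wz0].
(* Conversely, one round of back and forth: [f n] puts the index n into the domain and then into the
   range. *)
have next z : exists f : nat -> seq (nat * nat), forall n, W z w ->
    [/\ W (f n) w, {subset z <= f n}, exists c, (n, c) \in f n &
        exists x, (x, n) \in f n].
  have /choice[f fP] n : exists z', W z w -> [/\ W z' w, {subset z <= z'},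
      exists c, (n, c) \in z' & exists x, (x, n) \in z'].
    have [/S[/(_ n)[c /[dup] Wc /S[_ /(_ n)[x Wx] _]] _ _]|] := pselect (W z w); last first.
      by exists z.
    exists [:: (x, n), (n, c) & z] => _; split=> //.
    - by move=> p pz; rewrite !inE pz !orbT.
    - by exists c; rewrite !inE eqxx orbT.
    - by exists x; rewrite !inE eqxx.
  by exists f.
have {next}[f fP] := choice next.
pose zs := fix zs n := if n is m.+1 then f (zs m) m else z0.
have Wzs n : W (zs n) w by elim: n => //= n /(fP _ n)[].
have zsS n : {subset zs n <= zs n.+1} by have [] := fP _ n (Wzs n).
have zs_le m n : (m <= n)%N -> {subset zs m <= zs n}.
  elim: n => [|n IHn]; first by rewrite leqn0 => /eqP->.
  rewrite leq_eqVlt => /predU1P[->//|/IHn mn] p /mn; exact: zsS.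
pose rho x c := exists n, (x, c) \in zs n.
have [||||h [hi hr]] := @isomorphism_of_correspondence _ _ _ (e w) nu rho
  (@e_surj w) nu_surj.
- by move=> x; have [_ _ [c xc] _] := fP _ x (Wzs x); exists c, x.+1.
- by move=> c; have [_ _ _ [x xc]] := fP _ c (Wzs c); exists x, c.+1.
- move=> x c x' c' [m xm] [n xn].
  have [_ _ /same_atoms_nth] := S _ (Wzs (maxn m n)).
  move=> /(_ (x, c) (x', c')); apply.
    exact: (zs_le _ _ (leq_maxl _ _)).
  exact: (zs_le _ _ (leq_maxr _ _)).
- move=> r x c /choice[n nP].
  (* The arity is finite, so all pairs have appeared by a common stage. *)
  have [_ _ /same_atoms_rel] := S _ (Wzs (\max_k n k)); apply=> k.
  by apply: zs_le (nP k); exact: leq_bigmax.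
- by exists h; split=> // -[x c] xc; apply: hr; exists 0%N.
Qed.

Lemma measurable_isomorphic : measurable [set w | isomorphic (A w) N].
Proof.
rewrite (_ : mkset _ = extends_to_iso [::]); first exact: measurable_extends_to_iso.
by apply/seteqP; split=> w [h]; [exists h|case; exists h].
Qed.

End Scott.

(** * The space of labeled structures *)

Lemma cvg_prod_topology (I : Type) (T : I -> topologicalType)
    (F : set_system (prod_topology T)) (g : prod_topology T) : Filter F ->
  (forall i, (fun h : prod_topology T => h i) @ F --> g i) -> F --> g.
Proof.
move=> FF Fg; apply/cvg_sup => i A [_ [[B oB <-] Bg] sBA].
by apply: filterS sBA _; apply: (Fg i); apply: open_nbhs_nbhs.
Qed.

Section Cylinders.
Variable L : language.

Local Notation atom_code := {r : L & {ffun 'I_(arity r) -> nat}}.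

(** Finite functions make the atoms a countable type, so that there are countably many cylinders;
    this reads a code back as a plain function. *)
Definition code_args (c : atom_code) (k : 'I_(arity (tag c))) : nat := tagged c k.
Arguments code_args c k : clear implicits.

Definition cylinder (l : seq (bool * atom_code)) : set (XL L) :=
  [set g : XL L | forall c, c \in l -> g (tag c.2) (code_args c.2) = c.1].

Lemma open_coordinate (r : L) (i : 'I_(arity r) -> nat) (b : bool) :
  open [set g : XL L | g r i = b].
Proof.
have c1 := @proj_continuous L
  (fun r : L => {ptws ('I_(arity r) -> nat) -> bool}) r.
have c2 := @proj_continuous ('I_(arity r) -> nat)%type (fun _ => bool) i.
have := @continuousP (XL L) bool (fun g : XL L => g r i).
case=> [h _]; apply: (h _ [set b]) => [g|].
  exact: (@continuous_comp _ _ _ _ _ g (c1 g) (c2 _)).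
exact: discrete_open.
Qed.

Lemma cylinder_nil : cylinder [::] = setT.
Proof. by apply/seteqP; split. Qed.

Lemma cylinder_cat l l' : cylinder (l ++ l') = cylinder l `&` cylinder l'.
Proof.
apply/seteqP; split=> g.
  by move=> gl; split=> c cl; apply: gl; rewrite mem_cat cl ?orbT.
by move=> [gl gl'] c; rewrite mem_cat => /orP[/gl|/gl'].
Qed.

Lemma cylinder_cons c l :
  cylinder (c :: l) = [set g : XL L | g (tag c.2) (code_args c.2) = c.1] `&` cylinder l.
Proof.
rewrite -cat1s cylinder_cat; congr (_ `&` _); apply/seteqP; split=> g /=.
  by apply; rewrite inE.
by move=> gc c'; rewrite inE => /eqP->.
Qed.

Lemma open_cylinder l : open (cylinder l).
Proof.
elim: l => [|c l IHl]; first by rewrite cylinder_nil; exact: openT.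
by rewrite cylinder_cons; apply: openI => //; exact: open_coordinate.
Qed.

(** The cylinders around g generate a filter on which every coordinate is eventually constant, so it
    converges to g in the product topology. *)
Lemma cylinder_basis (O : set (XL L)) (g : XL L) : open O -> O g ->
  exists l, cylinder l g /\ cylinder l `<=` O.
Proof.
move=> oO Og.
pose F := filter_from [set l | cylinder l g] cylinder.
have FF : Filter F.
  apply: filter_from_filter; first by exists [::]; rewrite /mkset cylinder_nil.
  by move=> l l' gl gl'; exists (l ++ l'); rewrite /mkset cylinder_cat.
suff [l lg lO] : F O by exists l.
have : F --> g; last by apply; exact: open_nbhs_nbhs.
apply: cvg_prod_topology => r; apply: cvg_prod_topology => i A /nbhs_singleton Ag.
exists [:: (g r i, Tagged (fun r : L => {ffun 'I_(arity r) -> nat})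
  [ffun k => i k])].
  move=> c; rewrite inE => /eqP-> /=.
  by congr (g r _); apply/funext => k; rewrite /code_args/= ffunE.
move=> h /(_ _ (mem_head _ _)) /=.
have -> : code_args (Tagged (fun r : L => {ffun 'I_(arity r) -> nat})
    [ffun k => i k]) = i.
  by apply/funext => k; rewrite /code_args/= ffunE.
by move=> ->.
Qed.

Lemma open_bigcup_cylinder (O : set (XL L)) : open O ->
  O = \bigcup_(l in [set l | cylinder l `<=` O]) cylinder l.
Proof.
move=> oO; apply/seteqP; split=> g; last by move=> [l lO /lO].
by move=> /(cylinder_basis oO)[l [? ?]]; exists l.
Qed.

(** An open set is a union of cylinders, and there are only countably many cylinders. *)
Lemma sigma_cylinder :
  @measurable _ (borel (XL L)) = <<s range cylinder >>.
Proof.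
rewrite -[LHS]/(<<s @open (XL L) >>); apply/seteqP; split.
  apply: smallest_sub; first exact: smallest_sigma_algebra.
  move=> O /open_bigcup_cylinder ->; rewrite bigcup_mkcond.
  apply: (@countable_bigcupT_measurable _ (g_sigma_algebraType (range cylinder))) => [|l].
    exact: countableP.
  case: ifPn => _; last exact: (@measurable0 _ (g_sigma_algebraType (range cylinder))).
  by apply: sub_sigma_algebra; exists l.
apply: smallest_sub; first exact: smallest_sigma_algebra.
by move=> _ [l _ <-]; apply: sub_sigma_algebra; exact: open_cylinder.
Qed.

Lemma setI_closed_cylinder : setI_closed (range cylinder).
Proof. by move=> _ _ [l _ <-] [l' _ <-]; exists (l ++ l'); rewrite ?cylinder_cat. Qed.

Lemma cylinder_measure_unique (R : realType) (m m' : {measure set borel (XL L) -> \bar R}) :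
  (m setT < +oo)%E -> (forall l, m (cylinder l) = m' (cylinder l)) ->
  forall B, measurable B -> m B = m' B.
Proof.
move=> moo mm' B mB.
apply: (@measure_unique _ R (borel (XL L)) (range cylinder) (fun=> setT) _ _ _ _ m m') => //.
- exact: sigma_cylinder.
- exact: setI_closed_cylinder.
- by move=> _; exists [::] => //; exact: cylinder_nil.
- by rewrite bigcup_const//; exists 0%N.
- by move=> _ [l _ <-].
Qed.

Definition sym_inv (s : SymN) : SymN := Build_SymN (@sinvK s) (@spermK s).

Lemma relabelK (s : SymN) : cancel (@relabel L s) (@relabel L (sym_inv s)).
Proof.
move=> g; apply: functional_extensionality_dep => r; apply/funext => i.
rewrite /relabel /=.
by congr (g r _); apply/funext => k /=; rewrite spermK.
Qed.

Lemma relabel_image (s : SymN) (B : set (XL L)) :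
  @relabel L s @` B = @relabel L (sym_inv s) @^-1` B.
Proof.
apply/seteqP; split=> [_ [g Bg <-]|g Bg]; first by rewrite /preimage/= relabelK.
by exists (relabel (sym_inv s) g) => //; exact: (relabelK (sym_inv s)).
Qed.

End Cylinders.
Arguments code_args {L} c k.

(** * The map from types to labeled structures *)

Section Gmap.
Variables (L : language) (U : structure L).
Implicit Types p : stype nat [set: U].

Lemma stype_neg (X : Type) (A : set U) (p : stype X A) f : params_in A f -> p (FNeg f) <-> ~ p f.
Proof.
move=> Af; split=> [pn pf|npf]; last by have [] := formulas_complete p Af.
have [||e h] := @formulas_sat _ _ _ _ p [set f; FNeg f].
- by rewrite finite_setU; split; exact: finite_set1.
- by move=> _ [->|->].
have : psat (FNeg f) e by apply: h; right.
by apply; apply: h; left.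
Qed.

Lemma open_clopen (X : Type) (A : set U) f : params_in A f -> open (@clopen_of _ U X A f).
Proof.
move=> Af; suff : stone_open (@clopen_of _ U X A f) by [].
by move=> p pf; exists f; split.
Qed.

Definition literal (c : bool * {r : L & {ffun 'I_(arity r) -> nat}}) : pfml U nat :=
  let f := FRel (tag c.2) (fun k => inl (code_args c.2 k)) in
  if c.1 then f else FNeg f.

Definition cylinder_fml (l : seq (bool * {r : L & {ffun 'I_(arity r) -> nat}})) : pfml U nat :=
  FAnds [seq literal c | c <- l].

Lemma literalP c p : p (literal c) <-> (Gmap p : XL L) (tag c.2) (code_args c.2) = c.1.
Proof.
case: c => -[] c; rewrite /literal /Gmap/=.
  by split=> [?|/asboolP//]; apply/asboolP.
rewrite stype_neg//; split=> [?|/asboolP//].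
by apply/asboolP.
Qed.

Lemma preimage_cylinder l : @Gmap _ U @^-1` cylinder l = clopen_of setT (cylinder_fml l).
Proof.
elim: l => [|c l IHl].
  by rewrite cylinder_nil; apply/seteqP; split=> p // _; exact: stypeT.
rewrite cylinder_cons preimage_setI IHl; apply/seteqP; split=> p /=.
  by move=> [pc pl]; apply/stype_and; split=> //; apply/literalP.
by move=> /stype_and[/literalP].
Qed.

Lemma measurable_Gmap : measurable_fun setT (@Gmap L U : borel _ -> borel (XL L)).
Proof.
apply: (@measurability _ _ (borel (stype nat [set: U])) (borel (XL L)) setT _
  (range (@cylinder L))).
  exact: sigma_cylinder.
move=> _ [_ [l _ <-] <-]; rewrite setTI preimage_cylinder.
by apply: sub_sigma_algebra; exact: open_clopen.
Qed.

End Gmap.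

(** * Symmetry of the Morley powers *)

Definition swap (i j x : nat) : nat :=
  if x == i then j else if x == j then i else x.

Lemma swapK i j : involutive (swap i j).
Proof.
move=> x; rewrite /swap; have [->|xi] := eqVneq x i.
  by rewrite eqxx; case: eqP.
have [->|xj] := eqVneq x j; first by rewrite eqxx.
by rewrite (negbTE xi) (negbTE xj).
Qed.

Lemma swap_le n k i : (k < n)%N -> (i <= n)%N -> (swap k k.+1 i <= n)%N.
Proof. by rewrite /swap => kn ni; case: ifP => // _; case: ifP => // _; exact: ltnW. Qed.

Section AdjacentTransposition.
Variables n k : nat.
Hypothesis kn : (k < n)%N.

Definition adj (i : 'I_n.+1) : 'I_n.+1 := inord (swap k k.+1 i).

Lemma val_adj i : adj i = swap k k.+1 i :> nat.
Proof. by rewrite inordK// ltnS swap_le// -ltnS. Qed.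

Lemma adjK : involutive adj.
Proof. by move=> i; apply: val_inj; rewrite /= !val_adj swapK. Qed.

End AdjacentTransposition.

Lemma split_lastE n (i : 'I_n.+2) :
  split_last i = if i == n.+1 :> nat then inl ord0 else inr (inord i).
Proof.
rewrite /split_last; case: unliftP => [j|] ->; last by rewrite eqxx.
rewrite lift_max ltn_eqF//; congr inr; apply: val_inj.
by rewrite /= inordK// lift_max.
Qed.

Definition sum_map (X X' Y Y' : Type) (s : X -> X') (t : Y -> Y') (v : X + Y) :
    X' + Y' :=
  match v with inl x => inl (s x) | inr y => inr (t y) end.

(** A transposition that avoids the last variable acts on the inner factor of the Morley product
    only. *)
Lemma split_last_adj n k (i : 'I_n.+2) : (k < n)%N ->
  split_last (@adj n.+1 k i) = sum_map id (@adj n k) (split_last i).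
Proof.
move=> kn; have kn1 : (k < n.+1)%N by exact: ltnW.
rewrite !split_lastE val_adj//.
have [->|ni] := eqVneq (i : nat) n.+1.
  have -> : swap k k.+1 n.+1 = n.+1 by rewrite /swap !gtn_eqF// ltnW.
  by rewrite eqxx.
have ni' : (i < n.+1)%N by rewrite ltn_neqAle ni -ltnS ltn_ord.
rewrite ltn_eqF ?ltnS ?swap_le//=; congr inr; apply: val_inj.
by rewrite /= val_adj// !inordK// ltnS swap_le.
Qed.

(** * Pulling types back along maps of variables *)

Section Pullback.
Variables (L : language) (U : structure L).

Lemma eq_stype (X : Type) (A : set U) (p q : stype X A) :
  (forall f, p f <-> q f) -> p = q.
Proof.
case: p q => [p p1 p2 p3] [q q1 q2 q3] /= pq.
have e : p = q by apply/funext => f; apply/propext.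
move: q1 q2 q3; rewrite -e => q1 q2 q3.
by rewrite (Prop_irrelevance p1 q1) (Prop_irrelevance p2 q2) (Prop_irrelevance p3 q3).
Qed.

Lemma stype_or (X : Type) (A : set U) (p : stype X A) f g :
  params_in A f -> params_in A g -> p (FOr f g) <-> p f \/ p g.
Proof.
move=> Af Ag; rewrite stype_neg; last by move=> u [/Af|/Ag].
rewrite stype_and !stype_neg//; split=> [/not_andP[/contrapT|/contrapT]|].
- by left.
- by right.
- by move=> fg [nf ng]; case: fg.
Qed.

Section Map.
Variables (X Y : Type) (A : set U) (s : X -> Y) (q : stype Y A).

Let pull : pfml U X -> Prop := [set f | q (vmap s f)].

Let pull_over : pull `<=` params_in A.
Proof. by move=> f /formulas_over /params_in_vmap. Qed.

Let pull_sat (F : set (pfml U X)) : finite_set F -> F `<=` pull ->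
  exists e : X -> U, forall f, F f -> psat f e.
Proof.
move=> finF Fp; have [||e eP] := @formulas_sat _ _ _ _ q (vmap s @` F).
- exact: finite_image.
- by move=> _ [f /Fp qf <-].
- exists (e \o s) => f Ff; apply/psat_vmap.
  by apply: eP; exists f.
Qed.

Let pull_complete f : params_in A f -> pull f \/ pull (FNeg f).
Proof. by move=> Af; apply: (@formulas_complete _ _ _ _ q); apply/params_in_vmap. Qed.

Definition stype_pull : stype X A := SType pull_over pull_sat pull_complete.

End Map.

Lemma stype_pullK (X Y : Type) (A : set U) (s : X -> Y) (s' : Y -> X) :
  cancel s' s -> cancel (@stype_pull X Y A s) (stype_pull s').
Proof.
move=> sK q; apply: eq_stype => f; rewrite /= /mkset vmap_comp.
have -> : s \o s' = id by apply/funext.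
by rewrite vmap_id.
Qed.

Lemma preimage_pull (X Y : Type) (A : set U) (s : X -> Y) (f : pfml U X) :
  @stype_pull X Y A s @^-1` clopen_of A f = clopen_of A (vmap s f).
Proof. by []. Qed.

Lemma continuous_stype_pull (X Y : Type) (A : set U) (s : X -> Y) (O : set (stype X A)) :
  open O -> open (@stype_pull X Y A s @^-1` O).
Proof.
move=> oO; suff : stone_open (@stype_pull X Y A s @^-1` O) by [].
have sO : stone_open O by [].
move=> q /sO[f [Af qf fO]]; exists (vmap s f); split=> //.
  exact/params_in_vmap.
by move=> q' q'f; exact: fO.
Qed.

Lemma measurable_stype_pull (X Y : Type) (A : set U) (s : X -> Y) :
  measurable_fun setT (@stype_pull X Y A s : borel _ -> borel _).
Proof.
apply: (@measurability _ _ (borel (stype Y A)) (borel (stype X A)) setT _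
  (@open (stype X A))) => //.
move=> _ [V oV <-]; rewrite setTI; apply: sub_sigma_algebra.
exact: continuous_stype_pull.
Qed.

Lemma realizes_pull (X Y : Type) (A : set U) (s : X -> Y) (q : stype Y A) (b : Y -> U) :
  realizes q id b -> realizes (stype_pull s q) id (b \o s).
Proof. by move=> qb f /qb /psat_vmap. Qed.

(** By inner regularity it suffices to bound compact subsets of O. Such a set is covered by finitely
    many clopen sets inside O, and their disjunction is again one clopen set inside O. *)
Lemma regular_open (R : realType) (X : Type) (A : set U)
    (m : probability (borel (stype X A)) R) (O : set (stype X A)) :
  regular_measure m -> open O -> forall x : \bar R,
  (forall f, params_in A f -> clopen_of A f `<=` O -> (m (clopen_of A f) <= x)%E) ->
  (m O <= x)%E.
Proof.
move=> reg oO x fx.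
have mO : measurable (O : set (borel (stype X A))) by exact: sub_sigma_algebra.
have [_ ->] := reg O mO.
apply: ge_ereal_sup => _ [C [cptC clC CO] <-].
(* [{classic _}] provides the choice structure that finite index sets of a cover require. *)
pose D := [set f : {classic pfml U X} | params_in A f /\ clopen_of A f `<=` O].
have [s sD sC] : finite_subset_cover D (fun f => clopen_of A f) C.
  move: cptC; rewrite compact_cover; apply; first by move=> f [Af _]; exact: open_clopen.
  have sO : stone_open O by [].
  by move=> q /CO /sO[f [Af qf fO]]; exists f.
have [g [[Ag gO] sg]] : exists g, D g /\
    forall f : {classic pfml U X}, f \in s -> clopen_of A f `<=` clopen_of A g.
  have : {subset enum_fset s <= D} by [].
  suff H (l : seq {classic pfml U X}) : {subset l <= D} ->
    exists g, D g /\ forall f : {classic pfml U X}, f \in l ->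
      clopen_of A f `<=` clopen_of A g by exact: H.
  elim: l => [|f l IHl] lD.
    exists (FNeg FTop); split=> //; split; first by move=> u.
    by move=> q /stype_neg; case=> //; exact: stypeT.
  have [|g [[Ag gO] lg]] := IHl; first by move=> h hl; apply: lD; rewrite inE hl orbT.
  have [Af fO] : D f by apply/set_mem/lD; rewrite inE eqxx.
  exists (FOr f g); split.
    split; first by move=> u /= [/Af|/Ag].
    by move=> q /stype_or[]// /[dup]; [move=> /fO|move=> /gO].
  by move=> h; rewrite inE => /predU1P[-> q qf|/lg hg q /hg qg]; apply/stype_or => //; [left|right].
apply: le_trans (fx _ Ag gO); apply: le_measure; rewrite ?inE.
- rewrite -[C]setCK; apply: (@measurableC _ (borel (stype X A))).
  by apply: sub_sigma_algebra; exact: closed_openC.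
- by apply: sub_sigma_algebra; exact: open_clopen.
- by move=> q /sC[f fs qf]; exact: (sg f).
Qed.

End Pullback.

(** * Symmetries of Morley products *)

Section Exchangeability.
Variables (R : realType) (L : language) (U : structure L) (M : set U).

Section RestrictionInvariance.
Variables (Y : Type) (A : set U) (s s' : Y -> Y).
Hypotheses (sK : cancel s s') (s'K : cancel s' s).

(** Open sets form a generating pi-system, and regularity reduces each inequality on an open set to
    the clopen sets inside it; these are moved by s in one direction and by its inverse in the
    other. *)
Lemma stype_pull_preserving (m : probability (borel (stype Y A)) R) :
  regular_measure m ->
  (forall f, params_in A f -> m (clopen_of A (vmap s f)) = m (clopen_of A f)) ->
  forall B : set (borel (stype Y A)), measurable B ->
  m (stype_pull s @^-1` B) = m B.
Proof.
move=> reg mf B mB.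
have open_le (O : set (stype Y A)) (x : \bar R) : open O ->
    (forall f, params_in A f -> clopen_of A f `<=` O -> (m (clopen_of A f) <= x)%E) ->
    (m O <= x)%E by move=> oO; exact: regular_open.
have mO (O : set (stype Y A)) : open O -> measurable (O : set (borel (stype Y A))).
  exact: sub_sigma_algebra.
have mclopen f : params_in A f -> measurable (clopen_of A f : set (borel (stype Y A))).
  by move=> Af; apply: mO; exact: open_clopen.
pose h : borel (stype Y A) -> borel (stype Y A) := @stype_pull _ _ _ _ _ s.
have mh : measurable_fun setT h := measurable_stype_pull s.
pose m' := pushforward m h : {measure set (borel (stype Y A)) -> \bar R}.
rewrite -[LHS]/(m' mh B).
apply: (@measure_unique _ R (borel (stype Y A)) (@open (stype Y A)) (fun=> setT)) => //.
- exact: openI.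
- by move=> _; exact: openT.
- by rewrite bigcup_const//; exists 0%N.
- move=> O oO; apply/eqP; rewrite eq_le; apply/andP; split.
    rewrite -[m' mh O]/(m (h @^-1` O)).
    apply: open_le; first exact: continuous_stype_pull.
    move=> f Af fO; have Af' : params_in A (vmap s' f) by apply/params_in_vmap.
    have <- : m (clopen_of A (vmap s' f)) = m (clopen_of A f).
      rewrite -mf// vmap_comp.
      have -> : s \o s' = id by apply/funext.
      by rewrite vmap_id.
    apply: le_measure; rewrite ?inE; [exact: mclopen|exact: mO|].
    move=> q qf; have /fO : clopen_of A f (stype_pull s' q) by [].
    by rewrite /preimage /h /= (stype_pullK sK).
  apply: open_le => // f Af fO; rewrite -mf//.
  apply: le_measure; rewrite ?inE.
  - by apply: mclopen; apply/params_in_vmap.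
  - by apply: mO; exact: continuous_stype_pull.
  - by move=> q qf; apply: fO.
- by move=> _; rewrite -[m' mh _]/(m (h @^-1` setT)) preimage_setT probability_setT ltry.
Qed.

(** The default point is the type of a constant tuple, hence fixed by reindexing. This settles the
    case where [restriction] takes its Dirac default. *)
Lemma stype_pull_point (q : stype Y A) : q = point -> stype_pull s q = point.
Proof. by move=> ->; apply: eq_stype => f /=; rewrite /mkset params_in_vmap psat_vmap. Qed.

Lemma restriction_pull (nu : pfml U Y -> R) :
  (forall f, params_in A f -> nu (vmap s f) = nu f) ->
  forall B : set (borel (stype Y A)), measurable B ->
  restriction nu A (stype_pull s @^-1` B) = restriction nu A B.
Proof.
move=> nus B mB; rewrite /restriction; case: pselect => [h|_].
  have [reg mnu] := projT2 (cid h); apply: stype_pull_preserving => // f Af.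
  rewrite !mnu ?nus//; exact/params_in_vmap.
rewrite /= /dirac !indicE; congr (_%:R%:E).
have e := stype_pull_point (erefl (point : stype Y A)).
by congr nat_of_bool; apply/idP/idP; rewrite !inE /preimage/= ?e// -[X in B X]e.
Qed.

(** Realizations of q and of its pullback correspond through s and s', so [get] chooses from the
    same set of values on both sides. *)
Lemma fiber_vmapr (X : Type) (mu : pfml U X -> R) (f : pfml U (X + Y)) (q : stype Y A) :
  fiber mu (vmap (sum_map id s) f) q = fiber mu f (stype_pull s q).
Proof.
rewrite /fiber; congr (xget _ _); apply/seteqP; split=> r /= [b qb ->].
  by exists (b \o s); [exact: realizes_pull|rewrite plug_vmapr].
exists (b \o s').
  by have := @realizes_pull L U _ _ A s' _ _ qb; rewrite (stype_pullK s'K).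
rewrite plug_vmapr; congr (mu (plug f _)); apply/funext => y /=.
by rewrite sK.
Qed.

End RestrictionInvariance.

Lemma fiber_ge0 (X Y : Type) (mu : pfml U X -> R) (A : set U) (f : pfml U (X + Y))
    (q : stype Y A) : (forall g, 0 <= mu g) -> 0 <= fiber mu f q.
Proof.
move=> mu0; rewrite /fiber; case: xgetP => [r _ [b _ ->]//|_].
(* On the empty set [get] returns the default point of [R], which is 0. *)
exact: (lexx (0 : R)).
Qed.

(** A symmetry of [nu] is a change of variables on the type space preserving the measure against
    which one integrates. *)
Lemma morley_vmapr (X : Type) (n : nat) (mu : pfml U X -> R) (nu : pfml U 'I_n -> R)
    (s : 'I_n -> 'I_n) (f : pfml U (X + 'I_n)) :
  (forall g, 0 <= mu g) -> borel_definable M mu -> involutive s ->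
  (forall g, params_in M g -> nu (vmap s g) = nu g) -> params_in M f ->
  morley M mu nu (vmap (sum_map id s) f) = morley M mu nu f.
Proof.
move=> mu0 bmu sK nus Mf; rewrite /morley params_vmap.
(* The integral thus lives over M itself, where definability makes the fibre Borel. *)
have -> : M `|` params f = M by apply/setUidPl.
rewrite /Rintegral; congr fine.
under eq_integral do rewrite (fiber_vmapr sK sK).
have mh := @measurable_stype_pull L U _ _ M s.
have -> : (\int[restriction nu M]_x (fiber mu f (stype_pull s x))%:E =
  \int[pushforward (restriction nu M) (stype_pull s : borel _ -> borel _)]_x
     (fiber mu f x)%:E)%E.
  rewrite ge0_integral_pushforward//.
    by apply/measurable_realfun.measurable_EFinP; exact: bmu.
  by move=> q _; rewrite lee_fin; exact: fiber_ge0.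
apply: eq_measure_integral => B mB _.
exact: restriction_pull.
Qed.

(** A symmetry of the outer measure leaves every value of the fibre unchanged, so the integrands
    coincide. *)
Lemma morley_vmapl (X Y : Type) (mu : pfml U X -> R) (nu : pfml U Y -> R)
    (s : X -> X) (f : pfml U (X + Y)) : (forall g, mu (vmap s g) = mu g) ->
  morley M mu nu (vmap (sum_map s id) f) = morley M mu nu f.
Proof.
move=> mus; rewrite /morley params_vmap; congr (Rintegral _ _ _).
apply/funext => q; rewrite /fiber; congr (xget _ _).
by apply/seteqP; split=> r /= [b qb ->]; exists b; rewrite ?plug_vmapl ?mus.
Qed.

Lemma pindex_lt (t : ptree) (v : pvar t) : (pindex v < (psize t).+1)%N.
Proof.
elim: t v => [|l IHl r IHr] //= [v|v].
  by rewrite -addSn addnS ltnS -addSn leq_add2r.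
by rewrite (leq_trans (IHr v))// ltnS leqW// leq_addl.
Qed.

Lemma pindex_surj (t : ptree) (i : nat) : (i < (psize t).+1)%N ->
  exists v : pvar t, pindex v = i.
Proof.
elim: t i => [|l IHl r IHr] i /= it; first by exists ord0; case: i it.
have [ir|ri] := ltnP i (psize r).+1.
  by have [v <-] := IHr _ ir; exists (inr v).
have [|v vi] := IHl (i - (psize r).+1)%N.
  by rewrite ltn_subLR// addSn addnS -addnS addnC.
by exists (inl v); rewrite vi subnK.
Qed.

Variable mu : pfml U 'I_1 -> R.

(* Parenthesizing mu^(n+3) as (mu (x) mu) (x) mu^(n+1), the commutation of mu
   with itself becomes a symmetry of the fibres of the outer product. *)
Lemma morley_power_adj_last (r : ptree) (f : pfml U 'I_(psize r).+3) :
  excellent M mu ->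
  morley_power M mu (psize r).+2 (vmap (@adj (psize r).+2 (psize r).+1) f) =
  morley_power M mu (psize r).+2 f.
Proof.
move=> [[_ assoc] comm].
pose t := PNode (PNode PLeaf PLeaf) r.
(* [kappa] renames the variables by the leaves of [t], inverting their numbering. *)
have /choice[kappa kappaP] : forall i : 'I_(psize t).+1, exists v : pvar t, pindex v = i.
  by move=> i; exact: pindex_surj.
(* The two leaves of the left subtree carry the two highest numbers, so exchanging them is the
   transposition of the last two variables. *)
pose sw : pvar t -> pvar t := sum_map (@sum_swap _ _) id.
have symm g : pproduct M mu t (vmap sw g) = pproduct M mu t g.
  by apply: morley_vmapl => h; rewrite -comm.
have := symm (vmap kappa f); rewrite !assoc !vmap_comp.
have -> : (fun v : pvar t => inord (pindex v) : 'I_(psize t).+1) \o kappa = id.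
  by apply/funext => i; rewrite -[LHS]/(inord (pindex (kappa i))) kappaP inord_val.
rewrite vmap_id => <-. congr (morley_power M mu _ _); apply: eq_vmap => i _.
apply: val_inj; rewrite /= val_adj// inordK; last exact: (@pindex_lt t).
rewrite -(kappaP i) /swap /sw /=; case: (kappa i) => [[v|v]|v] /=.
- by rewrite !add0n add1n gtn_eqF// eqxx.
- by rewrite !add0n add1n eqxx.
- have lt1 := pindex_lt v; have lt2 : (pindex v < (psize r).+2)%N by exact: ltnW.
  by rewrite (ltn_eqF lt1) (ltn_eqF lt2).
Qed.

(** Associativity allows any tree with the right number of leaves as the inner factor; a right comb
    is one. *)
Lemma psize_comb (n : nat) : exists r, psize r = n.
Proof. by exists (iter n (PNode PLeaf) PLeaf); elim: n => //= n ->. Qed.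

Lemma morley_power_adj (n k : nat) (f : pfml U 'I_n.+1) :
  (forall g, 0 <= mu g) -> excellent M mu -> (k < n)%N -> params_in M f ->
  morley_power M mu n (vmap (@adj n k) f) = morley_power M mu n f.
Proof.
move=> mu0 exc; elim: n f => // n IHn f; rewrite ltnS leq_eqVlt => /predU1P[->|kn] Mf.
  (* The last two variables: for two factors this is commutation itself, beyond that it needs
     associativity. *)
  case: n f {IHn} Mf => [|n] f Mf.
    rewrite /= exc.2 !vmap_comp; congr morley; apply: eq_vmap => i _ /=.
    rewrite !split_lastE val_adj// /swap.
    have o0 : inord 0 = ord0 :> 'I_1 by rewrite ord1.
    by case: i => -[|[|]]//= _; rewrite ?o0.
  by have [r rn] := psize_comb n; move: f Mf; rewrite -rn => f _; exact: morley_power_adj_last.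
(* A lower pair lies in the inner factor, where the induction hypothesis makes the transposition a
   symmetry. *)
rewrite /= vmap_comp.
have -> : @split_last n \o @adj n.+1 k = sum_map id (@adj n k) \o @split_last n.
  by apply/funext => i; exact: split_last_adj.
rewrite -vmap_comp; apply: morley_vmapr => //.
- exact: (exc.1.1 0%N).
- exact: adjK.
- by move=> g Mg; exact: IHn.
- exact/params_in_vmap.
Qed.

End Exchangeability.

(** * Invariance of the push-forward *)

Section Permutations.
Variables (R : realType) (L : language) (U : structure L) (M : set U).
Variables (mu : pfml U 'I_1 -> R) (P : probability (borel (stype nat [set: U])) R).
Hypotheses (mu0 : forall f, 0 <= mu f) (exc : excellent M mu) (hP : is_Pmu M mu P).

(** Parameters stay in M because the change of variables in [morley_vmapr] is made over M; the
    formulas to which the property is finally applied are parameter-free. *)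
Definition P_preserving (s : nat -> nat) : Prop := forall f : pfml U nat,
  params_in M f -> P (clopen_of setT (vmap s f)) = P (clopen_of setT f).

Lemma P_preserving_comp s t : P_preserving s -> P_preserving t ->
  P_preserving (s \o t).
Proof. by move=> Ps Pt f Mf; rewrite -vmap_comp Ps ?Pt//; exact/params_in_vmap. Qed.

Lemma P_preserving_swapS k : P_preserving (swap k k.+1).
Proof.
(* The bound n covers the variables of f as well as k and k+1, so that the swap acts within the
   first n+1 variables. *)
move=> f Mf; have [m fm] := vars_bounded f; pose n := maxn m k.+1.
have fE : f = vmap (@nat_of_ord n.+1) (vmap (fun i => inord i) f).
  rewrite vmap_comp -[LHS]vmap_id; apply: eq_vmap => i /fm im /=.
  by rewrite inordK// ltnS leq_max im.
have kn : (k < n)%N by rewrite leq_max leqnn orbT.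
rewrite fE vmap_comp.
have -> : swap k k.+1 \o @nat_of_ord n.+1 = @nat_of_ord n.+1 \o adj k.
  by apply/funext => i /=; rewrite val_adj.
rewrite -vmap_comp !hP.2 morley_power_adj//.
exact/params_in_vmap.
Qed.

Lemma swap_id i : swap i i = id.
Proof. by apply/funext => x; rewrite /swap; case: eqP. Qed.

Lemma swapC i j : swap i j = swap j i.
Proof.
apply/funext => x; rewrite /swap; case: eqP => [->|_//].
by case: eqP => // ->.
Qed.

(** Conjugation by adjacent transpositions produces all transpositions. *)
Lemma swap_step i j : (i < j)%N ->
  swap i j.+1 = swap j j.+1 \o (swap i j \o swap j j.+1).
Proof.
move=> ij; apply/funext => x; rewrite /= /swap.
by repeat case: eqP; lia.
Qed.

Lemma P_preserving_swap i j : P_preserving (swap i j).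
Proof.
wlog ij : i j / (i <= j)%N.
  by move=> H; have [|/ltnW] := leqP i j => /H//; rewrite swapC.
elim: j ij => [|j IHj]; first by rewrite leqn0 => /eqP-> f _; rewrite swap_id vmap_id.
rewrite leq_eqVlt => /predU1P[->|]; first by move=> f _; rewrite swap_id vmap_id.
rewrite ltnS leq_eqVlt => /predU1P[->|ij]; first exact: P_preserving_swapS.
rewrite swap_step//; apply: P_preserving_comp; first exact: P_preserving_swapS.
by apply: P_preserving_comp; [exact/IHj/ltnW|exact: P_preserving_swapS].
Qed.

(** Values are corrected one at a time: composing t with the transposition of [t n] and [s n]
    repairs the value at n and, by injectivity of s and t, moves none of the earlier ones. *)
Lemma P_preserving_agree (s : nat -> nat) n : injective s ->
  exists t, [/\ P_preserving t, injective t & forall i, (i < n)%N -> t i = s i].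
Proof.
move=> sI; elim: n => [|n [t [Pt tI ts]]].
  by exists id; split=> // f _; rewrite vmap_id.
exists (swap (t n) (s n) \o t); split.
- by apply: P_preserving_comp => //; exact: P_preserving_swap.
- by apply: inj_comp => //; exact: (can_inj (swapK _ _)).
move=> i; rewrite ltnS leq_eqVlt => /predU1P[->|lin] /=; rewrite /swap ?eqxx//.
rewrite ts//; case: eqP => [e|_].
  have /tI ein : t i = t n by rewrite ts.
  by rewrite ein ltnn in lin.
by case: eqP => // /sI e; rewrite e ltnn in lin.
Qed.

Lemma P_preserving_injective (s : nat -> nat) : injective s -> P_preserving s.
Proof.
move=> sI f Mf; have [n fn] := vars_bounded f.
have [t [Pt _ ts]] := P_preserving_agree n.+1 sI.
by rewrite -(Pt f)//; congr (P (clopen_of _ _)); apply: eq_vmap => i /fn /ts.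
Qed.

Lemma probability_eq_vars (m n : nat) : not_on_points mu -> m <> n ->
  P (clopen_of setT (FEq (inl m) (inl n))) = 0%E.
Proof.
(* By symmetry the later variable, which is the outer one of a Morley product, may be taken on the
   left. *)
move=> pts; wlog nm : m n / (n < m)%N.
  move=> H /eqP; rewrite neq_ltn => /orP[mn|nm]; last by apply: H => //; lia.
  have <- := @P_preserving_swap m n (FEq (inl m) (inl n)).
    rewrite /vmap /= /swap eqxx; have -> : (n == m) = false by lia.
    by rewrite eqxx H//; lia.
  by move=> u [].
case: m nm => // m nm _.
have -> : FEq (inl m.+1) (inl n) =
    vmap (@nat_of_ord m.+2) (FEq (inl ord_max) (inl (inord n))) :> pfml U nat.
  by rewrite /vmap /= inordK// ltnW.
rewrite hP.2 /morley_power -/morley_power /morley; congr EFin.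
rewrite /Rintegral integral0_eq// => q _; congr EFin.
(* A value of the fibre is the measure of a point, hence 0, and the default of [get] is 0 too. *)
rewrite /fiber; case: xgetP => [r _ [b _ ->]|_//].
rewrite /plug /vmap /= !split_lastE/= eqxx inordK; last exact: ltnW.
by rewrite ltn_eqF.
Qed.

End Permutations.

Lemma measure_ex_eq0 d (T : measurableType d) (R : realType)
    (m : {measure set T -> \bar R}) (I : countType) (F : I -> set T) :
  (forall i, measurable (F i)) -> (forall i, m (F i) = 0%E) ->
  m [set w | exists i, F i w] = 0%E.
Proof.
move=> mF F0; apply/negligibleP; first exact: measurable_ex.
pose G n := if choice.unpickle n is Some i then F i else set0.
have -> : [set w | exists i, F i w] = \bigcup_n G n.
  apply/seteqP; split=> w [i]; first by exists (choice.pickle i); rewrite /G ?choice.pickleK.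
  by rewrite /G; case: choice.unpickle => // j _ Fj; exists j.
apply: negligible_bigcup => n; rewrite /G; case: choice.unpickle => [i|].
  by apply/(negligibleP m (mF i)); exact: F0.
exact: negligible_set0.
Qed.

(** * The push-forward measure and relabeling *)

Section Transport.
Variables (R : realType) (L : language) (U : structure L).
Implicit Types p : stype nat [set: U].

Lemma params_cylinder_fml (M : set U) l : params_in M (@cylinder_fml L U l).
Proof.
by elim: l => [|[[] c] l IHl] u //= [|/IHl//]; move=> [].
Qed.

Lemma measurable_Splus : measurable (Splus U : set (borel (stype nat [set: U]))).
Proof.
apply: measurable_all => m; apply: measurable_all => n.
apply: measurable_imp; first exact: measurable_prop.
by apply: sub_sigma_algebra; exact: (@open_clopen L U nat setT).
Qed.

Lemma measurable_preimage_G (B : set (borel (XL L))) : measurable B ->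
  measurable (@Gmap L U @^-1` B : set (borel (stype nat [set: U]))).
Proof. by move=> mB; rewrite -[X in measurable X]setTI; exact: measurable_Gmap. Qed.

Variables (M : set U) (mu : pfml U 'I_1 -> R).
Variable P : probability (borel (stype nat [set: U])) R.
Hypotheses (mu0 : forall f, 0 <= mu f) (exc : excellent M mu) (hP : is_Pmu M mu P).
Hypothesis pts : not_on_points mu.

Lemma probability_setC_Splus : P (~` Splus U) = 0%E.
Proof.
have -> : ~` Splus U = [set p : stype nat [set: U] | exists mn : nat * nat,
    [set p : stype nat [set: U] | mn.1 <> mn.2 /\ p (FEq (inl mn.1) (inl mn.2))] p].
  apply/seteqP; split=> p.
    move=> /existsNP[m /existsNP[n /not_implyP[mn]]].
    by rewrite stype_neg// => /contrapT pmn; exists (m, n).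
  by move=> [[m n] /= [mn pmn]] /(_ m n mn); rewrite stype_neg.
have clE m n : [set p : stype nat [set: U] | m <> n /\ p (FEq (inl m) (inl n))] =
    if m == n then set0 else @clopen_of L U nat setT (FEq (inl m) (inl n)).
  case: eqP => mn; apply/seteqP; split=> p //; first by case.
  by case.
apply: measure_ex_eq0 => -[m n]; rewrite clE; case: ifPn => //=.
  by move=> _; apply: sub_sigma_algebra; exact: (@open_clopen L U nat setT).
by move=> /eqP mn; exact: (probability_eq_vars mu0 exc hP).
Qed.

Lemma measure_setI_Splus (B : set (borel (stype nat [set: U]))) :
  measurable B -> P (Splus U `&` B) = P B.
Proof.
move=> mB; have mS := measurable_Splus.
apply/eqP; rewrite eq_le; apply/andP; split.
  by apply: le_measure; rewrite ?inE//; exact: measurableI.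
rewrite -[leRHS]adde0 -probability_setC_Splus.
apply: le_trans (measureU2 _ _ _) => //.
- apply: le_measure; rewrite ?inE//.
    by apply: measurableU; [exact: measurableI|exact: measurableC].
  by move=> p Bp; have [Sp|Sp] := pselect (Splus U p); [left|right].
- exact: measurableI.
- exact: measurableC.
Qed.

(** Identifies the set function [Gpush] with a push-forward measure, to which uniqueness on
    cylinders applies. *)
Lemma GpushE (B : set (borel (XL L))) : measurable B ->
  Gpush P B = P (@Gmap L U @^-1` B).
Proof. by move=> mB; rewrite /Gpush measure_setI_Splus//; exact: measurable_preimage_G. Qed.

(** Relabeling by the inverse of s corresponds under G to pulling types back along s. *)
Lemma preimage_relabel (s : SymN) (B : set (XL L)) :
  @Gmap L U @^-1` (@relabel L s @` B) = (@Gmap L U \o stype_pull s) @^-1` B.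
Proof. by rewrite relabel_image. Qed.

Lemma measurable_Gmap_pull (s : SymN) : measurable_fun setT
  (@Gmap L U \o stype_pull s : borel (stype nat [set: U]) -> borel (XL L)).
Proof.
exact: (measurableT_comp (@measurable_Gmap L U)
  (@measurable_stype_pull L U nat nat setT s)).
Qed.

Lemma measurable_relabel (s : SymN) (B : set (borel (XL L))) : measurable B ->
  measurable (@relabel L s @` B : set (borel (XL L))).
Proof.
rewrite relabel_image => mB.
rewrite -[X in measurable X]setTI; move: B mB.
suff : measurable_fun setT (@relabel L (sym_inv s) : borel (XL L) -> borel (XL L)).
  by move=> h B mB; exact: h.
apply: (@measurability _ _ (borel (XL L)) (borel (XL L)) setT _ (range (@cylinder L))).
  exact: sigma_cylinder.
move=> _ [_ [l _ <-] <-]; rewrite setTI.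
elim: l => [|c l IHl]; first by rewrite cylinder_nil preimage_setT; exact: measurableT.
rewrite cylinder_cons preimage_setI; apply: measurableI => //.
apply: sub_sigma_algebra; exact: (@open_coordinate L (tag c.2)).
Qed.

Lemma Gpush_relabel (s : SymN) (B : set (borel (XL L))) : measurable B ->
  Gpush P (@relabel L s @` B) = Gpush P B.
Proof.
move=> mB; rewrite !GpushE//; last exact: measurable_relabel.
rewrite preimage_relabel.
pose m1 := pushforward P (@Gmap L U \o stype_pull s : borel _ -> borel (XL L))
  : {measure set (borel (XL L)) -> \bar R}.
pose m2 := pushforward P (@Gmap L U : borel _ -> borel (XL L))
  : {measure set (borel (XL L)) -> \bar R}.
apply: (@cylinder_measure_unique L R (m1 (measurable_Gmap_pull s))
  (m2 (@measurable_Gmap L U))) => //.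
  rewrite -[ltLHS]/(P (_ @^-1` setT)) preimage_setT probability_setT; exact: ltry.
move=> l; rewrite -[LHS]/(P (_ @^-1` _)) -[RHS]/(P (_ @^-1` _)).
rewrite comp_preimage preimage_cylinder preimage_pull.
apply: (P_preserving_injective mu0 exc hP); first exact: (can_inj (@spermK s)).
exact: params_cylinder_fml.
Qed.

End Transport.

(** * Isomorphism classes *)

Section Isomorphisms.
Variable L : language.

Lemma isomorphism_comp (A B C : structure L) (h : A -> B) (k : B -> C) :
  is_isomorphism h -> is_isomorphism k -> is_isomorphism (k \o h).
Proof.
by move=> [bh hr] [bk kr]; split; [exact: bij_comp|move=> r i; rewrite hr kr].
Qed.

Lemma isomorphism_inv (A B : structure L) (h : A -> B) (g : B -> A) :
  is_isomorphism h -> cancel h g -> cancel g h -> is_isomorphism g.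
Proof.
move=> [_ hr] hK gK; split; first by exists h.
move=> r i; rewrite hr; suff -> : h \o (g \o i) = i by [].
by apply/funext => k /=; rewrite gK.
Qed.

Lemma isomorphic_trans (A B C : structure L) :
  isomorphic A B -> isomorphic B C -> isomorphic A C.
Proof. by move=> [h ih] [k ik]; exists (k \o h); exact: isomorphism_comp. Qed.

Section Realizations.
Variables (U V : structure L) (p : stype nat [set: U]) (j : U -> V) (a : nat -> V).
Hypothesis pa : realizes p j a.

Definition enumeration (n : nat) : range a := exist _ (a n) (mem_set (imageT a n)).

Lemma enumeration_surj (y : range a) : exists n, enumeration n = y.
Proof.
case: y => y yP; have [n _ any] := set_mem yP; exists n.
exact: eq_exist.
Qed.

Lemma realizesP (f : pfml U nat) : p f <-> sat f (assign a j).
Proof.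
split=> [/pa//|fa]; have [//|/pa] : p f \/ p (FNeg f) by exact: (@formulas_complete _ _ _ _ p).
by move=> /(_ fa).
Qed.

Lemma eq_enumeration m n : enumeration m = enumeration n <-> p (FEq (inl m) (inl n)).
Proof.
rewrite realizesP /=; split=> [[]//|amn]; exact: eq_exist.
Qed.

Lemma interp_enumeration (a0 : range a !=set0) (r : L) (i : 'I_(arity r) -> nat) :
  interp (induced_structure a0) r (enumeration \o i) <->
  p (FRel r (fun k => inl (i k))).
Proof. by rewrite realizesP. Qed.

(** On S^+ a realization has no repetitions, so sending a label to its entry is a bijection onto the
    range. *)
Lemma labeled_isomorphic (a0 : range a !=set0) : Splus U p ->
  isomorphic (labeled (Gmap p)) (induced_structure a0).
Proof.
move=> Sp; have := @isomorphism_of_correspondence L (labeled (Gmap p))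
  (induced_structure a0) id enumeration eq.
case=> [||||||h [ih _]]; last by exists h.
- by move=> n; exists n.
- exact: enumeration_surj.
- by move=> x; exists x.
- by move=> x; exists x.
- move=> x _ x' _ <- <-; split=> [->//|/eq_enumeration pxx'].
  apply: contrapT => /(Sp x x').
  by rewrite stype_neg.
- move=> r x c xc; have <- : x = c by apply/funext.
  by rewrite interp_enumeration; split=> [/asboolP//|?]; exact/asboolP.
Qed.

End Realizations.

(** The type fixes the atomic diagram, so membership in [BN] can be tested on any single
    realization. *)
Lemma realizations_isomorphic (U V V' : structure L) (p : stype nat [set: U])
    (j : U -> V) (a : nat -> V) (a0 : range a !=set0)
    (j' : U -> V') (a' : nat -> V') (a0' : range a' !=set0) :
  realizes p j a -> realizes p j' a' ->
  isomorphic (induced_structure a0) (induced_structure a0').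
Proof.
move=> pa pa'; have := @isomorphism_of_correspondence L (induced_structure a0)
  (induced_structure a0') (enumeration a) (enumeration a') eq.
case=> [||||||h [ih _]]; last by exists h.
- exact: enumeration_surj.
- exact: enumeration_surj.
- by move=> x; exists x.
- by move=> x; exists x.
- by move=> x _ x' _ <- <-; rewrite (eq_enumeration pa) (eq_enumeration pa').
- move=> r x c xc; have <- : x = c by apply/funext.
  by rewrite (interp_enumeration pa) (interp_enumeration pa').
Qed.

End Isomorphisms.

Section IsomorphismClass.
Variables (L : language) (N : structure L) (nu : nat -> N).
Hypothesis nu_surj : forall y, exists n, nu n = y.

Lemma measurable_BN (U : structure L) :
  measurable (BN U N : set (borel (stype nat [set: U]))).
Proof.
(* One realization is chosen for each type, without regard to measurability: Scott's theorem looks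
   only at the atomic events, and these are clopen. *)
have ex (p : stype nat [set: U]) : exists Vja : {V : structure L & ((U -> V) * (nat -> V))%type},
    elementary_map (tagged Vja).1 /\ realizes p (tagged Vja).1 (tagged Vja).2.
  have [V [j [a pa]]] := stype_realized p.
  by exists (Tagged (fun V : structure L => ((U -> V) * (nat -> V))%type) (j, a)).
have [F FP] := choice ex.
pose a p : nat -> tag (F p) := (tagged (F p)).2.
have a0 p : range (a p) !=set0 by exists (a p 0%N); exact: imageT.
have pa p : realizes p (tagged (F p)).1 (a p) := (FP p).2.
have -> : BN U N = [set p | isomorphic (induced_structure (a0 p)) N].
  apply/seteqP; split=> p.
    move=> [V [j [a' [a0' [_ pa' iN]]]]].
    exact: isomorphic_trans (realizations_isomorphic _ _ (pa p) pa') iN.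
  by move=> iN; exists (tag (F p)), (tagged (F p)).1, (a p), (a0 p); split=> //; exact: (FP p).1.
apply: (@measurable_isomorphic _ (borel (stype nat [set: U])) L
  (fun p => induced_structure (a0 p)) (fun p => enumeration (a p)) _ _ _ N nu).
- by move=> p; exact: enumeration_surj.
- move=> m n; have -> : [set p | enumeration (a p) m = enumeration (a p) n] =
      clopen_of setT (FEq (inl m) (inl n)).
    by apply/seteqP; split=> p; rewrite /= (eq_enumeration (pa p)).
  by apply: sub_sigma_algebra; exact: open_clopen.
- move=> r i; have -> : [set p | interp (induced_structure (a0 p)) r
      (enumeration (a p) \o i)] = clopen_of setT (FRel r (fun k => inl (i k))).
    by apply/seteqP; split=> p; move/(interp_enumeration (pa p) (a0 p) i).
  by apply: sub_sigma_algebra; exact: open_clopen.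
- exact: nu_surj.
Qed.

Definition labeled_extends (z : seq (nat * nat)) : set (borel (XL L)) :=
  @extends_to_iso _ (borel (XL L)) L (@labeled L) (fun _ n => n) N nu z.

Lemma measurable_labeled_rel (r : L) (i : 'I_(arity r) -> nat) :
  measurable ([set g | interp (labeled g) r i] : set (borel (XL L))).
Proof.
have -> : [set g | interp (labeled g) r i] = [set g : XL L | g r i = true] by [].
by apply: sub_sigma_algebra; exact: open_coordinate.
Qed.

Lemma measurable_labeled_extends z : measurable (labeled_extends z).
Proof.
apply: measurable_extends_to_iso => //.
- by move=> g y; exists y.
- by move=> i j; exact: (@measurable_prop _ (borel (XL L)) (i = j)).
- by move=> r i; exact: measurable_labeled_rel.
Qed.

Lemma labeled_extends_nil : labeled_extends [::] = [set g | isomorphic (labeled g) N].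
Proof. by apply/seteqP; split=> g [h]; [case; exists h|exists h]. Qed.

Lemma relabel_labeled_extends (s : SymN) z :
  @relabel L s @` labeled_extends z `<=`
  labeled_extends [seq (s p.1, p.2) | p <- z].
Proof.
move=> _ [g [h [[bh hr] hz]] <-]; exists (h \o sinv s); split; last first.
  by move=> _ /mapP[p pz ->] /=; rewrite spermK hz.
split; first by apply: bij_comp => //; exists s; [exact: sinvK|exact: spermK].
by move=> r i; rewrite -[interp _ r i]/(interp (labeled g) r (sinv s \o i)) hr.
Qed.

(** One isomorphism composed with the inverse of the other is an automorphism of N fixing A, hence
    fixing the element numbered c0; so both give that element the same label. *)
Lemma labeled_extends_disjoint (A : set N) (c0 : nat) (w : seq (nat * nat)) (z z' : nat)
    (g : XL L) :
  gdcl A (nu c0) -> (forall y, A y -> exists2 p, p \in w & nu p.2 = y) ->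
  labeled_extends ((z, c0) :: w) g -> labeled_extends ((z', c0) :: w) g -> z = z'.
Proof.
move=> cA wA [h [ih hw]] [h' [ih' hw']].
have [[k hK kK] _] := ih; have [[k' hK' _] _] := ih'.
have hz := hw _ (mem_head _ _); have hz' := hw' _ (mem_head _ _).
apply: (can_inj hK'); rewrite hz' /=.
have <- := cA (h' \o k) (isomorphism_comp (isomorphism_inv ih hK kK) ih') _.
  by rewrite /= -hz hK.
move=> y /wA[p pw <-] /=.
have pw' q : p \in q :: w by rewrite inE pw orbT.
by rewrite -[in LHS](hw _ (pw' _)) hK (hw' _ (pw' _)).
Qed.

End IsomorphismClass.

(** * Trivial definable closure *)

(** Any n of the disjoint sets have total measure at most 1, so n x is at most 1 for every n. *)
Lemma trivIset_measure_le0 d (T : measurableType d) (R : realType)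
    (P : {measure set T -> \bar R}) (F : nat -> set T) (x : \bar R) :
  P setT = 1%E -> (forall k, measurable (F k)) -> trivIset setT F -> (forall k, x <= P (F k))%E ->
  (x <= 0)%E.
Proof.
move=> PT mF tF xF; rewrite leNgt; apply/negP => x0.
have P1 A : measurable A -> (P A <= 1)%E by move=> mA; rewrite -PT le_measure ?inE.
have xfin : x \is a fin_num.
  rewrite ge0_fin_numE ?(ltW x0)//; apply: le_lt_trans (xF 0%N) _.
  by apply: le_lt_trans (ltry 1); exact: P1.
have nx n : (fine x * n%:R <= 1)%R.
  rewrite -lee_fin.
  have -> : ((fine x * n%:R)%:E = \sum_(k < n) x)%E.
    by rewrite -[in RHS](fineK xfin) sumEFin sumr_const card_ord mulr_natr.
  apply: (@le_trans _ _ (\sum_(k < n) P (F k))%E); first exact: lee_sum.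
  rewrite -measure_bigsetU_ord//; last first.
    by move=> i j _ _ /(tF _ _ Logic.I Logic.I) /val_inj.
  by apply: P1; exact: bigsetU_measurable.
have x0' : 0 < fine x by rewrite fine_gt0// x0 ltey_eq xfin.
have := nx (Num.bound (fine x)^-1).
apply/negP; rewrite -ltNge -ltr_pdivrMl// mulr1.
by apply: archi_boundP; rewrite invr_ge0 ltW.
Qed.

Section TrivialClosure.
Variables (R : realType) (L : language) (N : structure L) (nu : nat -> N).
Hypothesis nu_surj : forall y, exists n, nu n = y.
Variable m : {measure set (borel (XL L)) -> \bar R}.
Hypothesis mT : m setT = 1%E.
Hypothesis m_inv : forall (s : SymN) (B : set (borel (XL L))), measurable B ->
  m (@relabel L s @` B) = m B.

Lemma exchangeable_gdcl_eq0 (A : set N) (c0 : nat) (w : seq (nat * nat)) (z : nat) :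
  gdcl A (nu c0) -> ~ A (nu c0) ->
  (forall p, p \in w -> A (nu p.2)) ->
  (forall y, A y -> exists2 p, p \in w & nu p.2 = y) ->
  m (labeled_extends nu ((z, c0) :: w)) = 0%E.
Proof.
(* A label already given to an element of A would force the element numbered c0 into A. *)
move=> cA nAc wA Aw; pose E z := labeled_extends nu ((z, c0) :: w).
have mE z' : measurable (E z') by exact: measurable_labeled_extends.
rewrite -/(E z); have [zw|zw] := boolP (z \in unzip1 w).
  have -> : E z = set0.
    apply/seteqP; split=> // g [h [_ hw]]; apply: nAc.
    have /mapP[p pw zp] := zw.
    have := hw _ (mem_head _ _) => /= <-.
    by rewrite zp hw ?inE ?pw ?orbT//; exact: wA.
  exact: measure0.
(* Labels from b on are fresh: they differ from z and from all labels in w. *)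
pose b := (\max_(x <- z :: unzip1 w) x).+1.
pose f (k : nat) := (k + b)%N.
have fP k x : x \in z :: unzip1 w -> (x < f k)%N.
  move=> xw; rewrite /f /b addnS ltnS; apply: leq_trans (leq_addl _ _).
  exact: (@leq_bigmax_seq _ _ xpredT id).
(* Transposing z and [f k] preserves the measure and fixes every label in w. *)
have leE k : (m (E z) <= m (E (f k)))%E.
  pose s := Build_SymN (@swapK z (f k)) (@swapK z (f k)).
  rewrite -(m_inv s)//; apply: le_measure; rewrite ?inE//.
    exact: measurable_relabel.
  move=> g /relabel_labeled_extends; congr labeled_extends.
  rewrite /= {1}/swap eqxx; congr (_ :: _).
  rewrite -[RHS]map_id; apply/eq_in_map => -[x y] xyw /=; congr pair.
  have xw : x \in unzip1 w by apply/mapP; exists (x, y).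
  rewrite /swap; case: eqP => [xz|_]; first by rewrite -xz xw in zw.
  case: eqP => // xf; have := @fP k x; rewrite inE xw orbT => /(_ isT).
  by rewrite xf ltnn.
have E_disj : trivIset setT (E \o f).
  move=> k k' _ _ [g [gk gk']].
  exact: addIn (labeled_extends_disjoint cA Aw gk gk').
apply/eqP; rewrite eq_le measure_ge0 andbT.
by apply: (trivIset_measure_le0 mT _ E_disj leE) => k; exact: mE.
Qed.

Hypothesis m_iso : m [set g | isomorphic (labeled g) N] = 1%E.

Lemma exchangeable_trivial_gdcl : trivial_gdcl N.
Proof.
move=> A finA; apply/seteqP; split=> [c cA|c Ac h _]; last exact.
apply: contrapT => nAc.
have [xi xiP] := choice nu_surj.
have /finite_seqP[s sP] : finite_set (xi @` A) by exact: finite_image.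
have As y : A y -> xi y \in s.
  by move=> Ay; have : (xi @` A) (xi y) by [exists y]; rewrite sP.
have sA x : x \in s -> A (nu x).
  by move=> xs; have : [set` s] x by []; rewrite -sP => -[y Ay <-]; rewrite xiP.
pose good (w : seq (nat * nat)) := (forall p, p \in w -> A (nu p.2)) /\
  (forall y, A y -> exists2 p, p \in w & nu p.2 = y).
(* The index records a label for c and a finite labelling of exactly the elements of A; there are
   countably many such indices. *)
pose F (zw : nat * seq (nat * nat)) : set (borel (XL L)) :=
  [set g | good zw.2 /\ labeled_extends nu ((zw.1, xi c) :: zw.2) g].
have FE zw : F zw = if `[< good zw.2 >] then labeled_extends nu ((zw.1, xi c) :: zw.2)
                    else set0.
  by case: asboolP => gzw; apply/seteqP; split=> g //; [case|case].
have mF zw : measurable (F zw).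
  by rewrite FE; case: ifP => // _; exact: measurable_labeled_extends.
have F0 zw : m (F zw) = 0%E.
  rewrite FE; case: asboolP => // -[wA Aw].
  by apply: (@exchangeable_gdcl_eq0 A) => //; rewrite xiP.
have := measure_ex_eq0 mF F0.
have -> : [set g | exists zw, F zw g] = [set g | isomorphic (labeled g) N].
  apply/seteqP; split=> g [].
    by move=> zw [_ [h [ih _]]]; exists h.
  move=> h /[dup] ih [[k hK kK] _].
  (* The labels are read off from the inverse [k] of the given isomorphism. *)
  exists (k c, [seq (k (nu x), x) | x <- s]); split; last first.
    exists h; split=> // p; rewrite inE => /predU1P[->|/mapP[x _ ->]] /=.
      by rewrite kK xiP.
    by rewrite kK.
  split=> [p /mapP[x xs ->]|y Ay]; first exact: sA.
  by exists (k y, xi y); rewrite /= ?xiP//; apply/mapP; exists (xi y); rewrite ?xiP//; exact: As.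
move=> m0; have : 1%E = 0%E :> \bar R by rewrite -m_iso; exact: m0.
by move=> /eqP; rewrite onee_eq0.
Qed.

End TrivialClosure.

Lemma countable_surjection (T : Type) : inhabited T -> countable [set: T] ->
  exists nu : nat -> T, forall y, exists n, nu n = y.
Proof.
move=> [t0] /countable_injP[f fI].
have /choice[nu nuP] : forall n, exists y, forall x, f x = n -> y = x.
  move=> n; have [[x xn]|nx] := pselect (exists x, f x = n).
    by exists x => x' x'n; apply: fI; rewrite ?inE// xn.
  by exists t0 => x xn; case: nx; exists x.
by exists nu => y; exists (f y); exact: nuP.
Qed.

Theorem theorem4p16 (R : realType) (L : language) (T : set (sentence L))
  (K : Type) (U : structure L) (M : set U) (mu : pfml U 'I_1 -> R)
  (P : probability (borel (stype nat [set: U])) R) (N : structure L)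
  (hT : complete_theory T) (hUT : model U T) (hU : monster U K)
  (hMU : elementary_substructure M) (hM : small K M)
  (hmu : invariant_over M mu) (hpts : not_on_points mu) (hext : extension_axiom M mu)
  (hP : is_Pmu M mu P)
  (hN : countable [set: N]) (hPN : P (BN U N) = 1%E) :
  [/\ forall (s : SymN) (B : set (borel (XL L))), measurable B ->
        Gpush P (relabel s @` B) = Gpush P B,
      measurable ([set g | isomorphic (labeled g) N] : set (borel (XL L))) /\
        Gpush P [set g | isomorphic (labeled g) N] = 1%E
    & trivial_gdcl N].
Proof.
have [[_ mu0 _ _] _] := hmu; have [exc _] := hext.
have [nu nu_surj] := countable_surjection (inhab N) hN.
have inv (s : SymN) (B : set (borel (XL L))) : measurable B ->
    Gpush P (relabel s @` B) = Gpush P B.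
  exact: (Gpush_relabel mu0 exc hP hpts).
have miso : measurable ([set g | isomorphic (labeled g) N] : set (borel (XL L))).
  by rewrite -(labeled_extends_nil nu); exact: measurable_labeled_extends.
have iso1 : Gpush P [set g | isomorphic (labeled g) N] = 1%E.
  have mG := measurable_preimage_G (U := U) miso.
  apply/eqP; rewrite eq_le; apply/andP; split.
    by apply: probability_le1; apply: measurableI => //; exact: measurable_Splus.
  have mBN : measurable (BN U N : set (borel (stype nat [set: U]))).
    exact: measurable_BN nu_surj U.
  (* Intersecting with S^+ costs no measure, and there B_N lies in the preimage of the isomorphism
     class. *)
  rewrite -hPN -(measure_setI_Splus mu0 exc hP hpts mBN).
  apply: le_measure; rewrite ?inE.
  - by apply: measurableI => //; exact: measurable_Splus.
  - by apply: measurableI => //; exact: measurable_Splus.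
  - move=> p [Sp [V [j [a [a0 [_ pa iN]]]]]]; split=> //.
    exact: isomorphic_trans (labeled_isomorphic pa a0 Sp) iN.
split=> //.
pose m := pushforward P (@Gmap L U : borel _ -> borel (XL L))
  : {measure set (borel (XL L)) -> \bar R}.
have mE (B : set (borel (XL L))) : measurable B ->
    m (@measurable_Gmap L U) B = Gpush P B.
  by move=> mB; rewrite (GpushE mu0 exc hP hpts).
apply: (exchangeable_trivial_gdcl nu_surj (m := m (@measurable_Gmap L U))).
- exact: probability_setT.
- by move=> s B mB; rewrite !mE ?inv//; exact: measurable_relabel.
- by rewrite mE.
Qed.
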